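(* Let $P$ be a Borel probability distribution on $\mathbb{R}^d$, and let $d_{\mathrm{vol}}$ be its volume dimension (relative to the fixed set $\mathbb{X}\subset\mathbb{R}^d$). Suppose there exists a $d_M$-dimensional manifold $M\subset\mathbb{R}^d$ with positive reach satisfying $P(M\cap\mathbb{X})>0$ and $\mathrm{supp}(P)\subset M$. If $P$ has a bounded density $p$ with respect to the normalized $d_M$-dimensional Hausdorff measure $\lambda_{d_M}$ (on $M$), then $d_{\mathrm{vol}}=d_M$. In particular, when $P(\mathbb{X})>0$ and $P$ has a bounded density $p$ with respect to the $d$-dimensional Lebesgue measure $\lambda_d$, then $d_{\mathrm{vol}}=d$.
   Context: A (measurable) subset $\mathbb{X}\subset\mathbb{R}^d$ is fixed. $\mathbb{B}_{\mathbb{R}^d}(x,r)$ is the open Euclidean ball. The volume dimension of $P$ is $$d_{\mathrm{vol}}(P)=\sup\left\{\nu\ge0:\ \limsup_{r\to0}\sup_{x\in\mathbb{X}}\frac{P(\mathbb{B}_{\mathbb{R}^d}(x,r))}{r^\nu}<\infty\right\}.$$ ''Manifold'' means a closed embedded submanifold of $\mathbb{R}^d$, of dimension $d_M\in\{1,\dots,d\}$. $\lambda_\nu$ is the $\nu$-dimensional Hausdorff measure on $\mathbb{R}^d$ normalized so that a $\nu$-dimensional unit cube has measure $1$. The reach of a closed set $A\subset\mathbb{R}^d$ is $\tau_A=\inf_{q\in A,\,x\in\mathrm{Med}(A)}\|q-x\|$ (with $\inf\emptyset=\infty$), where $\mathrm{Med}(A)$ is the set of points of $\mathbb{R}^d\setminus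 A$ having at least two nearest points in $A$. *)

(* Defs.v *)
From mathcomp Require Import all_boot all_order all_algebra.
From mathcomp Require Import all_classical all_reals all_analysis.

Set Implicit Arguments.
Unset Strict Implicit.
Unset Printing Implicit Defensive.

Import Order.TTheory GRing.Theory Num.Theory.
Import numFieldNormedType.Exports.

Local Open Scope classical_set_scope.
Local Open Scope ring_scope.

Section euclidean_space.
Context {R : realType} {d : nat}.
Implicit Types (x y : 'rV[R]_d) (A M U : set 'rV[R]_d).

(* The library norm on 'rV is the sup norm; it induces the same topology. *)
Definition enorm x : R := Num.sqrt (\sum_(i < d) (x ord0 i) ^+ 2).

Definition eball x (r : R) : set 'rV[R]_d := [set y | enorm (y - x) < r].

Definition nearest A x : set 'rV[R]_d :=
  [set q | A q /\ forall a, A a -> enorm (x - q) <= enorm (x - a)].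

Definition medial_axis A : set 'rV[R]_d :=
  [set x | ~ A x /\ exists q1 q2, [/\ q1 <> q2, nearest A x q1 & nearest A x q2]].

(* [ereal_inf set0 = +oo]. *)
Definition reach A : \bar R :=
  ereal_inf [set (enorm (q - x))%:E | q in A & x in medial_axis A].

(* M is locally the image of a C^1 topological embedding phi with injective
   differential: U is open in the ambient space, V in R^m, and psi is a
   continuous inverse of phi : V -> M `&` U. The Jacobian is an m x d matrix
   acting on row vectors, hence [row_free]. As only C^1 regularity is
   required, smooth embedded submanifolds are included. *)
Definition embedded_submanifold (m : nat) M : Prop :=
  forall x, M x ->
  exists (U : set 'rV[R]_d) (V : set 'rV[R]_m)
    (phi : 'rV[R]_m -> 'rV[R]_d) (psi : 'rV[R]_d -> 'rV[R]_m),
  [/\ open U /\ U x,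
      open V /\ phi @` V = M `&` U,
      forall v, V v -> differentiable phi v /\ {for v, continuous (jacobian phi)},
      forall v, V v -> row_free (jacobian phi v)
    & {in V, cancel phi psi} /\ {within M `&` U, continuous psi}].

Definition diameter A : \bar R :=
  ereal_sup [set (enorm (x - y))%:E | x in A & y in A].

(* The empty set has cost 0 in every dimension, including m = 0. *)
Definition hausdorff_cost (m : nat) A : \bar R :=
  if A == set0 then 0%E else (fine (diameter A) ^+ m)%:E.

Definition hausdorff_pre (m : nat) (delta : R) A : \bar R :=
  ereal_inf [set (\sum_(0 <= k <oo) hausdorff_cost m (F k))%E |
    F in [set F : (set 'rV[R]_d)^nat |
      (forall k, (diameter (F k) <= delta%:E)%E) /\ A `<=` \bigcup_k F k]].

Definition hausdorff_unnormalized (m : nat) A : \bar R :=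
  ereal_sup [set hausdorff_pre m delta A | delta in [set delta : R | 0 < delta]].

(* [0, 1]^m x {0}^(d - m), to be used with m <= d. *)
Definition unit_cube (m : nat) : set 'rV[R]_d :=
  [set x | forall i : 'I_d, ((i < m)%N -> 0 <= x ord0 i <= 1) /\
                            ((m <= i)%N -> x ord0 i = 0)].

(* Normalized so that an m-dimensional unit cube has measure 1. This is an
   outer measure on all subsets; on Borel sets it is a measure. *)
Definition hausdorff (m : nat) A : \bar R :=
  ((fine (hausdorff_unnormalized m (unit_cube m)))^-1%:E *
   hausdorff_unnormalized m A)%E.

Definition box (ab : 'rV[R]_d * 'rV[R]_d) : set 'rV[R]_d :=
  [set x | forall i, ab.1 ord0 i <= x ord0 i <= ab.2 ord0 i].

(* Truncating the side lengths at 0 gives empty boxes volume 0. *)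
Definition box_volume (ab : 'rV[R]_d * 'rV[R]_d) : R :=
  \prod_(i < d) Num.max 0 (ab.2 ord0 i - ab.1 ord0 i).

(* d-dimensional Lebesgue outer measure, for 0 < d (for d = 0 every box has
   volume 1); on Borel sets it is Lebesgue measure. *)
Definition lebesgue_rV A : \bar R :=
  ereal_inf [set (\sum_(0 <= k <oo) (box_volume (F k))%:E)%E |
    F in [set F : ('rV[R]_d * 'rV[R]_d)^nat | A `<=` \bigcup_k box (F k)]].

End euclidean_space.

Definition borel_rV (R : realType) (d : nat) :=
  g_sigma_algebraType (@open 'rV[R]_d).

Section distribution.
Context {R : realType} {d : nat}.
Variable P : probability (borel_rV R d) R.

Definition prob_support : set 'rV[R]_d :=
  [set x | forall U : set 'rV[R]_d, open U -> U x -> (0 < P U)%E].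

(* P has a bounded density on D with respect to the set function mu, which is
   meant to be a measure on the Borel sets. *)
Definition has_bounded_density (mu : set (borel_rV R d) -> \bar R)
    (D : set (borel_rV R d)) : Prop :=
  exists p : borel_rV R d -> R,
  [/\ measurable_fun D p,
      exists K : R, forall x, D x -> 0 <= p x <= K
    & forall A : set (borel_rV R d), measurable A ->
        P A = (\int[mu]_(x in A `&` D) (p x)%:E)%E].

Definition volume_dimension (X : set 'rV[R]_d) : \bar R :=
  ereal_sup [set nu%:E | nu in [set nu : R | 0 <= nu /\
    (limf_esup
       (fun r : R => ereal_sup [set P (eball x r) / (r `^ nu)%:E | x in X])
       0^'+ < +oo)%E]].

End distribution.

(* Main.v *)
(* With T = reach / 2, every w orthogonal to the tangent space at p in M
   satisfies 2 T <w, z - p> <= |w| |z - p|^2 for all z in M. Rescaling a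
   Jacobian by its largest maximal minor, the tangent space at p is the graph of
   a linear map with entries in [-1, 1] over some m coordinates f. Hence M is,
   uniformly in p, a Lipschitz graph over the coordinates f near p, and there
   are finitely many choices of f. So M inside any ball of small radius r is
   covered by d^m N^m sets of diameter O(r / N). Letting N tend to infinity, the
   Hausdorff measure of M inside the ball is O(r^m), which gives d_vol >= m;
   if P(B(x, r)) <= K r^nu on X with nu > m, the same covers give
   P(M `&` X) = 0, so d_vol <= m. The Lebesgue case is the same with M the whole
   space, which is a graph over all the coordinates. *)
From HB Require Import structures.
Require Import Defs.
From mathcomp Require Import all_boot all_order all_algebra.
From mathcomp Require Import all_classical all_reals all_analysis.
From mathcomp Require Import measurable_realfun.
From mathcomp Require Import ring lra.

Set Implicit Arguments.
Unset Strict Implicit.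
Unset Printing Implicit Defensive.

Import Order.TTheory GRing.Theory Num.Theory.
Import numFieldNormedType.Exports.

Local Open Scope classical_set_scope.
Local Open Scope ring_scope.

(** * Euclidean norm *)

(** The charts of a submanifold have a size that varies with the point, and M need not be compact;
    they supply only the tangent space at each point, and all uniformity comes from the reach. The
    inequality for T says that the open ball of radius T tangent to M at p on the side of w contains
    no point of M. A nearest point gives at once such a ball of radius [enorm (x0 - a)] only;
    enlarging it to every T below [tau] is the hard step, done by maximizing a penalized distance
    over a compact ball. The largest minor bounds the slopes, so the Lipschitz constant depends only
    on d and m. Counting cells then gives both halves: N^m pieces of size r / N have a total
    m-dimensional cost free of N, while their P-mass under growth exponent nu is O(N^(m - nu)). A
    density is integrated against a bare set function, so the Hausdorff and Lebesgue outer measures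
    must first be shown to be measures on the Borel sets; Caratheodory's criterion for separated
    sets does this for both. *)

Section euclidean.
Context {R : realType} {d : nat}.
Implicit Types (x y z : 'rV[R]_d).

Definition dot x y : R := \sum_(i < d) x ord0 i * y ord0 i.

Lemma dotC x y : dot x y = dot y x.
Proof. by apply: eq_bigr => i _; rewrite mulrC. Qed.

Lemma dotDl x y z : dot (x + y) z = dot x z + dot y z.
Proof. by rewrite -big_split; apply: eq_bigr => i _; rewrite mxE mulrDl. Qed.

Lemma dotNl x y : dot (- x) y = - dot x y.
Proof. by rewrite -sumrN; apply: eq_bigr => i _; rewrite mxE mulNr. Qed.

Lemma dotZl (a : R) x y : dot (a *: x) y = a * dot x y.
Proof. by rewrite mulr_sumr; apply: eq_bigr => i _; rewrite mxE mulrA. Qed.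

Lemma dotDr x y z : dot x (y + z) = dot x y + dot x z.
Proof. by rewrite dotC dotDl !(dotC _ x). Qed.

Lemma dotNr x y : dot x (- y) = - dot x y.
Proof. by rewrite dotC dotNl dotC. Qed.

Lemma dotZr (a : R) x y : dot x (a *: y) = a * dot x y.
Proof. by rewrite dotC dotZl dotC. Qed.

Definition dotE := (dotDl, dotDr, dotNl, dotNr, dotZl, dotZr).

Lemma dotxx_ge0 x : 0 <= dot x x.
Proof. by apply: sumr_ge0 => i _; rewrite -expr2 sqr_ge0. Qed.

Lemma enormE x : enorm x = Num.sqrt (dot x x).
Proof. by congr Num.sqrt; apply: eq_bigr => i _; rewrite expr2. Qed.

Lemma enorm_ge0 x : 0 <= enorm x.
Proof. exact: sqrtr_ge0. Qed.

Lemma enorm_sqr x : enorm x ^+ 2 = dot x x.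
Proof. by rewrite enormE sqr_sqrtr ?dotxx_ge0. Qed.

Lemma coord_le_enorm x i : `|x ord0 i| <= enorm x.
Proof.
rewrite -sqrtr_sqr ler_sqrt; last by apply: sumr_ge0 => k _; exact: sqr_ge0.
by rewrite (bigD1 i)//= lerDl; apply: sumr_ge0 => k _; exact: sqr_ge0.
Qed.

Lemma enorm0_eq0 x : enorm x = 0 -> x = 0.
Proof.
move=> x0; apply/rowP => i; rewrite mxE; apply/eqP.
by rewrite -normr_le0 -x0 coord_le_enorm.
Qed.

Lemma enorm0 : enorm (0 : 'rV[R]_d) = 0.
Proof. by rewrite enormE -(scale0r 0) dotZl mul0r sqrtr0. Qed.

Lemma enormN x : enorm (- x) = enorm x.
Proof. by rewrite !enormE !dotE opprK. Qed.

Lemma enormC x y : enorm (x - y) = enorm (y - x).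
Proof. by rewrite -opprB enormN. Qed.

Lemma enormZ (a : R) x : enorm (a *: x) = `|a| * enorm x.
Proof.
by rewrite !enormE !dotE mulrA -expr2 sqrtrM ?sqr_ge0// sqrtr_sqr.
Qed.

(** Cauchy-Schwarz: the squared norm of [enorm y *: x - enorm x *: y] is [2 * enorm x * enorm y]
    times the difference of the two sides. *)
Lemma dot_le x y : dot x y <= enorm x * enorm y.
Proof.
have [x0|xn0] := eqVneq (enorm x) 0.
  by rewrite (enorm0_eq0 x0) -(scale0r 0) dotZl enormZ normr0 !mul0r.
have xgt0 : 0 < enorm x by rewrite lt0r xn0 enorm_ge0.
have := dotxx_ge0 (enorm y *: x - enorm x *: y).
rewrite !dotE -!enorm_sqr (dotC y x) => h.
have [y0|yn0] := eqVneq (enorm y) 0.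
  by rewrite (enorm0_eq0 y0) dotC -(scale0r 0) dotZl enormZ normr0 !mul0r mulr0.
have ygt0 : 0 < enorm y by rewrite lt0r yn0 enorm_ge0.
have : 0 <= (enorm x * enorm y) * (enorm x * enorm y - dot x y) by nra.
by rewrite pmulr_rge0 ?mulr_gt0// subr_ge0.
Qed.

Lemma enormD x y : enorm (x + y) <= enorm x + enorm y.
Proof.
rewrite -(@ler_pXn2r _ 2) ?nnegrE ?addr_ge0 ?enorm_ge0// enorm_sqr !dotE.
rewrite sqrrD !enorm_sqr (dotC y x).
by have := dot_le x y; lra.
Qed.

Lemma enormD_sqr x y :
  enorm (x + y) ^+ 2 = enorm x ^+ 2 + 2 * dot x y + enorm y ^+ 2.
Proof. by rewrite !enorm_sqr !dotE (dotC y x); ring. Qed.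

Lemma enormB_sqr x y :
  enorm (x - y) ^+ 2 = enorm x ^+ 2 - 2 * dot x y + enorm y ^+ 2.
Proof. by rewrite enormD_sqr dotNr enormN mulrN. Qed.

Lemma enorm_triangle x y z : enorm (x - z) <= enorm (x - y) + enorm (y - z).
Proof. by rewrite -(subrKA y) enormD. Qed.

Lemma norm_le_enorm x : `|x| <= enorm x.
Proof.
rewrite /Num.norm/= mx_normrE; apply/bigmax_leP; split=> [|[i j] _ /=].
  exact: enorm_ge0.
by rewrite (ord1 i) coord_le_enorm.
Qed.

Lemma coord_le_norm x i : `|x ord0 i| <= `|x|.
Proof.
rewrite [leRHS]/Num.norm/= mx_normrE.
by apply/bigmax_geP; right => /=; exists (ord0, i).
Qed.

Lemma enorm_le_sum x : enorm x <= \sum_(i < d) `|x ord0 i|.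
Proof.
have S0 : 0 <= \sum_(i < d) `|x ord0 i| by exact: sumr_ge0.
rewrite -(@ler_pXn2r _ 2) ?nnegrE ?enorm_ge0// enorm_sqr expr2 mulr_suml.
apply: ler_sum => i _; rewrite (le_trans (ler_norm _))// normrM ler_wpM2l//.
by rewrite (bigD1 i)//= lerDl sumr_ge0.
Qed.

Lemma enorm_le_coord x (e : R) :
  (forall i, `|x ord0 i| <= e) -> enorm x <= d%:R * e.
Proof.
move=> xe; apply: le_trans (enorm_le_sum x) _.
apply: le_trans (ler_sum _ (fun i _ => xe i)) _.
by rewrite sumr_const card_ord mulr_natl.
Qed.

Lemma enorm_le_norm x : enorm x <= d%:R * `|x|.
Proof. by apply: enorm_le_coord => i; exact: coord_le_norm. Qed.

(** The topology is that of the sup norm, whence the comparison factor d; exchanging x and y makes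
    the one-sided bound two-sided. *)
Lemma enorm_lipschitz_continuous (K : R) (f : 'rV[R]_d -> R) : 0 <= K ->
  (forall x y, f x <= f y + K * enorm (x - y)) -> continuous f.
Proof.
move=> K0 lipf x; have Kd0 : 0 <= K * d%:R by rewrite mulr_ge0.
 apply/(@cvgrPdist_le _ _ _ (nbhs x)) => e e0.
apply/(@nbhs_normP _ _ x); exists (e / (K * d%:R + 1)).
  by rewrite /= divr_gt0// ltr_wpDl.
move=> y /= /ltW xyd.
have xy : K * enorm (x - y) <= e.
  rewrite (le_trans (ler_wpM2l K0 (enorm_le_norm _)))// mulrA.
  move: xyd; rewrite ler_pdivlMr ?ltr_wpDl// => /(le_trans _) -> //.
  by rewrite mulrC ler_wpM2l// lerDl.
have := lipf x y; have := lipf y x.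
by rewrite (enormC y x) => h1 h2; rewrite ler_distl; apply/andP; split; lra.
Qed.

Lemma enormB_continuous z : continuous (fun x => enorm (x - z)).
Proof.
apply: (@enorm_lipschitz_continuous 1) => // x y.
by rewrite mul1r [leRHS]addrC; exact: enorm_triangle.
Qed.

Lemma open_eball x (r : R) : open (eball x r).
Proof.
rewrite (_ : eball x r = (fun y => enorm (y - x)) @^-1` [set t : R | t < r])//.
by have /continuousP := @enormB_continuous x; apply; exact: open_lt.
Qed.

Lemma closed_eball_le x (r : R) : closed [set y | enorm (y - x) <= r].
Proof.
rewrite (_ : [set y | _] = (fun y => enorm (y - x)) @^-1` [set t : R | t <= r])//.
by have /continuous_closedP := @enormB_continuous x; apply; exact: closed_le.
Qed.

Lemma compact_ecball x (r : R) (A : set 'rV[R]_d) : closed A ->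
  compact (A `&` [set y | enorm (y - x) <= r]).
Proof.
move=> cA; apply: bounded_closed_compact; last first.
  by apply: closedI => //; exact: closed_eball_le.
exists (enorm x + r); split; first exact: num_real.
move=> M hM y [_ /= yx]; apply: le_trans (norm_le_enorm y) _.
rewrite -(subrK x y) (le_trans (enormD _ _))//.
by apply: ltW; apply: le_lt_trans hM; rewrite addrC lerD2l.
Qed.

Lemma nbhs_eball x (A : set 'rV[R]_d) :
  nbhs x A -> exists2 e : R, 0 < e & eball x e `<=` A.
Proof.
move=> /nbhs_ballP[e /= e0 eA]; exists e => // y xy; apply: eA.
split=> // i j; rewrite (ord1 i).
rewrite -ball_normE /= distrC; apply: le_lt_trans xy.
by have := coord_le_enorm (y - x) j; rewrite !mxE.
Qed.

End euclidean.

(** * Nearest points and reach *)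

Section nearest_point.
Context {R : realType} {d : nat} (A : set 'rV[R]_d).
Hypothesis cA : closed A.
Implicit Types (x y z q a : 'rV[R]_d).

Lemma nearest_exists x : A !=set0 -> exists q, nearest A x q.
Proof.
move=> [a0 Aa0].
have K0 : (A `&` [set y | enorm (y - x) <= enorm (a0 - x)]) !=set0.
  by exists a0; split => /=.
have [q /set_mem[Aq /= qa0] qmin] := compact_EVT_min K0 (compact_ecball cA)
  (continuous_subspaceT (@enormB_continuous _ _ x)).
exists q; split => // a Aa; rewrite !(enormC x).
have [ax|/ltW/(le_trans qa0)//] := leP (enorm (a - x)) (enorm (a0 - x)).
by apply: qmin; rewrite inE.
Qed.

(** By compactness, the points of A at distance at least [e] from q are farther from x than q by a
    definite margin, whereas a nearest point of y is within [enorm (q - x) + 2 * enorm (y - x)] of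
    x. *)
Lemma nearest_continuous x q : nearest A x q ->
  (forall q', nearest A x q' -> q' = q) ->
  forall e : R, 0 < e -> exists2 eta : R, 0 < eta &
    forall y z, enorm (y - x) < eta -> nearest A y z -> enorm (z - q) < e.
Proof.
move=> [Aq qx] quniq e e0.
pose K := (A `&` [set y | e <= enorm (y - q)]) `&`
          [set y | enorm (y - x) <= enorm (q - x) + 1].
have cK : compact K.
  apply: compact_ecball; apply: closedI => //.
  by have /continuous_closedP/(_ _ (@closed_ge R e)) := @enormB_continuous R d q.
have memK y z (t : R) : t <= 2^-1 -> enorm (y - x) < t -> nearest A y z ->
    enorm (z - x) <= enorm (q - x) + 2 * t /\
    (~ enorm (z - q) < e -> K z).
  move=> t2 yx [Az zy].
  have zx : enorm (z - x) <= enorm (q - x) + 2 * t.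
    have := zy _ Aq; have := enorm_triangle z y x; rewrite (enormC z y).
    by have := enorm_triangle y x q; rewrite (enormC x q); lra.
  split=> // /negP; rewrite -leNgt => zq; split => //=.
  by apply: le_trans zx _; rewrite lerD2l; lra.
have [K0|K0] := pselect (K !=set0); last first.
  exists 2^-1 => // y z yx yz; apply: contrapT => zq.
  by apply: K0; exists z; have [//|_] := memK y z _ _ yx yz; apply.
have [c /set_mem Kc cmin] := compact_EVT_min K0 cK
  (continuous_subspaceT (@enormB_continuous _ _ x)).
have cx : enorm (q - x) < enorm (c - x).
  rewrite ltNge; apply/negP => cq.
  move: Kc => [[Ac /= ecq] _].
  suff cE : c = q by move: ecq; rewrite cE subrr enorm0 leNgt e0.
  apply: quniq; split => // a Aa; apply: le_trans (qx _ Aa).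
  by rewrite !(enormC x).
exists (Num.min 2^-1 ((enorm (c - x) - enorm (q - x)) / 2)).
  by rewrite lt_min invr_gt0 ltr0n/= divr_gt0// subr_gt0.
move=> y z yx yz; apply: contrapT => zq.
have [t [t2 yt tc]] : exists t, [/\ t <= 2^-1, enorm (y - x) < t &
    2 * t < enorm (c - x) - enorm (q - x)].
  move: yx; rewrite lt_min => /andP[y1 y2].
  have [?|?] := leP 2^-1 ((enorm (c - x) - enorm (q - x)) / 2).
    by exists ((enorm (y - x) + 2^-1) / 2); split; lra.
  by exists ((enorm (y - x) + (enorm (c - x) - enorm (q - x)) / 2) / 2); split; lra.
have [zx /(_ zq) Kz] := memK y z t t2 yt yz.
have := cmin _ (mem_set Kz); lra.
Qed.

End nearest_point.

(** * Unique nearest points give tangent balls of a fixed radius *)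

Section positive_reach.
Context {R : realType} {d : nat} (A : set 'rV[R]_d) (tau : R).
Hypothesis cA : closed A.
Hypothesis nearest_uniq : forall x q q1 q2, A q -> enorm (x - q) < tau ->
  nearest A x q1 -> nearest A x q2 -> q1 = q2.
Implicit Types (x y z q a : 'rV[R]_d).

(* Maximizing [dist(y, A) - (1 - e) |y - x0|] over [|y - x0| <= L] forces
   [|y - x0| = L], because the distance to A grows at unit speed when y moves
   away from its nearest point. *)
Lemma distance_ascent x0 a (L e : R) : nearest A x0 a -> 0 < enorm (x0 - a) ->
  0 <= L -> enorm (x0 - a) + L < tau -> 0 < e < 1 ->
  exists2 y, enorm (y - x0) = L &
    forall z, A z -> enorm (x0 - a) + (1 - e) * L <= enorm (y - z).
Proof.
move=> x0a s0 L0 sL /andP[e0 e1]; have [Aa amin] := x0a.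
have /choice[xi xiP] : forall x, exists q, nearest A x q.
  by move=> x; apply: nearest_exists => //; exists a.
pose delta x := enorm (x - xi x).
have delta_min x z : A z -> delta x <= enorm (x - z) by case: (xiP x) => _; apply.
have delta_lip x y : delta x <= delta y + enorm (x - y).
  have [Axi _] := xiP y.
  apply: le_trans (delta_min _ _ Axi) _.
  by rewrite [leRHS]addrC; exact: enorm_triangle.
have deltax0 : enorm (x0 - a) <= delta x0 by have [Axi _] := xiP x0; exact: amin.
pose g y := delta y - (1 - e) * enorm (y - x0).
have cg : continuous g.
  apply: (@enorm_lipschitz_continuous _ _ 2) => // x y; rewrite /g.
  have := delta_lip x y; have := enorm_triangle y x x0; rewrite (enormC y x) => h.
  have : (1 - e) * enorm (y - x0) <= (1 - e) * (enorm (x - y) + enorm (x - x0)).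
    by rewrite ler_wpM2l// subr_ge0 ltW.
  have := mulr_ge0 (ltW e0) (enorm_ge0 (x - y)).
  by rewrite mulrDr mulrBl mul1r; lra.
have B0 : (setT `&` [set y | enorm (y - x0) <= L]) !=set0.
  by exists x0; split => //=; rewrite subrr enorm0.
have [y /set_mem[_ /= yL] ymax] := compact_EVT_max B0
  (compact_ecball (@closedT _)) (continuous_subspaceT cg).
have gy : enorm (x0 - a) <= g y.
  have /ymax : x0 \in setT `&` [set y | enorm (y - x0) <= L].
    by rewrite inE; split => //=; rewrite subrr enorm0.
  by rewrite {1}/g subrr enorm0 mulr0 subr0; exact: le_trans.
have dy : enorm (x0 - a) + (1 - e) * enorm (y - x0) <= delta y.
  by move: gy; rewrite /g; lra.
suff yLE : enorm (y - x0) = L.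
  exists y => // z Az; rewrite -yLE; exact: le_trans (delta_min _ _ Az).
apply/eqP; rewrite eq_le yL leNgt /=; apply/negP => yltL.
have d0 : 0 < delta y.
  apply: lt_le_trans dy; rewrite ltr_pwDl// mulr_ge0 ?enorm_ge0// subr_ge0.
  exact: ltW.
have ya : enorm (y - a) < tau.
  by apply: le_lt_trans sL; have := enorm_triangle y x0 a; move: yL; lra.
(* A short move of y shifts its nearest point by less than [e * delta y / 2], half of the loss that
   a growth rate of [1 - e] can absorb. Uniqueness at y holds because [enorm (x0 - a) + L < tau]. *)
have [eta eta0 etaP] := nearest_continuous cA (xiP y)
  (fun q' yq' => nearest_uniq Aa ya yq' (xiP y)) (divr_gt0 (mulr_gt0 e0 d0) (ltr0n _ 2)).
pose h := Num.min (eta / 2) (L - enorm (y - x0)).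
have h0 : 0 < h by rewrite lt_min divr_gt0//= subr_gt0.
have hL : h <= L - enorm (y - x0) by rewrite ge_min lexx orbT.
have heta : h < eta by apply: le_lt_trans (_ : eta / 2 < _); [rewrite ge_min lexx|lra].
pose n := (delta y)^-1 *: (y - xi y).
have n1 : enorm n = 1.
  by rewrite enormZ gtr0_norm ?invr_gt0// -/(delta y) mulVf// gt_eqF.
pose y' := y + h *: n.
have y'y : enorm (y' - y) = h.
  by rewrite /y' addrAC subrr add0r enormZ n1 mulr1 gtr0_norm.
have y'L : enorm (y' - x0) <= enorm (y - x0) + h.
  by have := enorm_triangle y' y x0; rewrite y'y; lra.
have /ymax : y' \in setT `&` [set y | enorm (y - x0) <= L].
  by rewrite inE; split => //=; lra.
apply/negP; rewrite -ltNge.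
have zxi : enorm (xi y' - xi y) < e * delta y / 2.
  by apply: (etaP y') (xiP _); rewrite y'y.
suff dy' : delta y + (1 - e) * h < delta y'.
  rewrite /g; have : (1 - e) * enorm (y' - x0) <= (1 - e) * (enorm (y - x0) + h).
    by rewrite ler_wpM2l// subr_ge0 ltW.
  by rewrite mulrDr; lra.
have ndot : delta y - enorm (xi y' - xi y) <= dot n (y - xi y').
  have -> : y - xi y' = delta y *: n + - (xi y' - xi y).
    rewrite /n scalerA mulfV ?gt_eqF// scale1r opprB addrA subrK //.
  rewrite dotDr dotZr -enorm_sqr n1 expr1n mulr1 dotNr.
  by have := dot_le n (xi y' - xi y); rewrite n1; lra.
(* The squared distance from [y'] to [xi y'] is expanded around y, and [xi y'] is at distance at
   least [delta y] from y. *)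
have dy'2 : delta y ^+ 2 + 2 * h * dot n (y - xi y') + h ^+ 2 <= delta y' ^+ 2.
  rewrite /(delta y') (_ : y' - xi y' = (y - xi y') + h *: n); last first.
    by rewrite /y' addrAC.
  rewrite enormD_sqr enormZ (gtr0_norm h0) n1 mulr1 dotZr (dotC (y - _)).
  have [Axi _] := xiP y'.
  have := delta_min y _ Axi; rewrite -(@ler_pXn2r _ 2)// ?nnegrE ?enorm_ge0//.
  lra.
rewrite -(@ltr_pXn2r _ 2)// ?nnegrE ?enorm_ge0//; last first.
  by rewrite addr_ge0 ?(ltW d0)// mulr_ge0 ?(ltW h0)// subr_ge0 ltW.
apply: lt_le_trans dy'2.
have : h * (delta y - e * delta y / 2) < h * dot n (y - xi y').
  by rewrite ltr_pM2l//; lra.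
have : 0 < h * (e * delta y) by rewrite !mulr_gt0.
have : (1 - e) ^+ 2 * h ^+ 2 <= h ^+ 2.
  rewrite ler_piMl ?sqr_ge0// expr_le1//; lra.
rewrite !expr2; nra.
Qed.

(** With v the unit vector from a to x0, the conclusion says that z is at distance at least T from
    [c = a + T *: v]. A point y from the ascent with slack [e] is at distance [T - s] from x0 and
    nearly T from A, in particular from a; so it tends to c as [e] tends to 0, and the distance
    bound passes to c. *)
Lemma nearest_ball x0 a (T : R) : nearest A x0 a -> 0 < enorm (x0 - a) <= T ->
  T < tau -> forall z, A z ->
  2 * T * dot (x0 - a) (z - a) <= enorm (x0 - a) * enorm (z - a) ^+ 2.
Proof.
move=> x0a /andP[s0 sT] Ttau z Az.
set s := enorm (x0 - a) in s0 sT *.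
have [v [v1 x0E]] : exists v, enorm v = 1 /\ x0 = a + s *: v.
  exists (s^-1 *: (x0 - a)).
  rewrite enormZ gtr0_norm ?invr_gt0// mulVf ?gt_eqF//.
  by rewrite scalerA mulfV ?gt_eqF// scale1r addrC subrK.
pose c := a + T *: v; pose L := T - s.
have L0 : 0 <= L by rewrite subr_ge0.
have T0 : 0 < T by exact: lt_le_trans sT.
suff Tcz : T <= enorm (c - z).
  have : T ^+ 2 <= enorm (c - z) ^+ 2.
    by rewrite ler_pXn2r// ?nnegrE ?enorm_ge0// ltW.
  rewrite (_ : c - z = T *: v - (z - a)); last first.
    by rewrite /c; apply/rowP => j; rewrite !mxE; ring.
  rewrite (enormB_sqr (T *: v)) enormZ (gtr0_norm T0) v1 mulr1 dotZl.
  rewrite (_ : x0 - a = s *: v); last by rewrite x0E addrAC subrr add0r.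
  rewrite dotZl => h.
  have : 0 <= s * (enorm (z - a) ^+ 2 - 2 * T * dot v (z - a)).
    by rewrite mulr_ge0 ?(ltW s0)//; move: h; lra.
  by lra.
rewrite leNgt; apply/negP => czT; pose k := T - enorm (c - z).
have k0 : 0 < k by rewrite subr_gt0.
(* Both errors are of order [e]: squaring [k - e * L <= enorm (y - c)] costs [2 * k * L * e], and
   [enorm (y - c) ^+ 2] is at most [2 * L ^+ 2 * (T / s) * e]. *)
pose B := 2 * k * L + 2 * L ^+ 2 * (T / s).
have B0 : 0 <= B.
  by rewrite addr_ge0// !mulr_ge0 ?sqr_ge0 ?(ltW k0) ?(ltW T0)// invr_ge0 ltW.
suff kB (e : R) : 0 < e < 1 -> k ^+ 2 <= e * B.
  have k20 : 0 < k ^+ 2 by rewrite exprn_gt0.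
  have D0 : 0 < k ^+ 2 + B + 1 by lra.
  have := kB (k ^+ 2 / (k ^+ 2 + B + 1)).
  rewrite divr_gt0//= ltr_pdivrMr// mul1r mulrAC ler_pdivlMr//.
  have -> : k ^+ 2 < k ^+ 2 + B + 1 by lra.
  by move=> /(_ isT); rewrite ler_pM2l//; lra.
move=> e01; have /andP[e0 e1] := e01.
have sLtau : s + L < tau by rewrite addrC subrK.
have [y yx0 yP] := distance_ascent x0a s0 L0 sLtau e01.
move: yP; rewrite -/s => yP.
pose w := y - x0.
have wL : enorm w = L by [].
have yaE : y - a = s *: v + w by rewrite /w x0E; apply/rowP => j; rewrite !mxE; ring.
have ycE : y - c = w - L *: v.
  by rewrite /w /c x0E /L; apply/rowP => j; rewrite !mxE; ring.
have [Aa _] := x0a.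
have h1 : (s + (1 - e) * L) ^+ 2 <= s ^+ 2 + 2 * s * dot v w + L ^+ 2.
  have := yP _ Aa; rewrite yaE -(@ler_pXn2r _ 2)// ?nnegrE ?enorm_ge0//; last first.
    by rewrite addr_ge0 ?(ltW s0)// mulr_ge0// subr_ge0 ltW.
  rewrite enormD_sqr enormZ (gtr0_norm s0) v1 wL dotZl; lra.
have yc2 : enorm (y - c) ^+ 2 = 2 * L ^+ 2 - 2 * L * dot v w.
  rewrite ycE enormB_sqr enormZ (ger0_norm L0) v1 wL dotZr (dotC w); ring.
have h2 : k <= enorm (y - c) + e * L.
  by have := yP _ Az; have := enorm_triangle y c z; rewrite /k /L; lra.
have h3 : L - dot v w <= e * L * (T / s).
  rewrite mulrA ler_pdivlMr//.
  have -> : T = s + L by rewrite /L addrC subrK.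
  by move: h1; have := mulr_ge0 (sqr_ge0 e) (sqr_ge0 L); rewrite !expr2; nra.
have h4 : L * (L - dot v w) <= L * (e * L * (T / s)) by rewrite ler_wpM2l.
have [keL|eLk] := leP k (e * L).
  have : k * k <= k * (e * L) by rewrite ler_pM2l.
  have : 0 <= e * (k * L) by rewrite !mulr_ge0// ltW.
  have : 0 <= e * (L ^+ 2 * (T / s)).
    by rewrite !mulr_ge0 ?sqr_ge0 ?(ltW e0) ?(ltW T0)// invr_ge0 ltW.
  by rewrite /B expr2; lra.
have : (k - e * L) ^+ 2 <= enorm (y - c) ^+ 2.
  by rewrite ler_pXn2r// ?nnegrE ?enorm_ge0//; lra.
rewrite yc2 /B; move: h4; have := mulr_ge0 (sqr_ge0 e) (sqr_ge0 L).
rewrite !expr2; lra.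
Qed.

End positive_reach.

(** * Normal vectors of a submanifold of positive reach *)

Section tangent.
Context {R : realType} {d : nat}.
Implicit Types (x y z q a p w : 'rV[R]_d).

(** Outside A, two nearest points would put x on the medial axis, too close to q; a point of A is
    its own only nearest point. An infinite reach is replaced by 1. *)
Lemma reach_nearest_uniq (A : set 'rV[R]_d) : (0 < reach A)%E ->
  exists2 tau : R, 0 < tau & forall x q q1 q2, A q -> enorm (x - q) < tau ->
    nearest A x q1 -> nearest A x q2 -> q1 = q2.
Proof.
move=> rA.
have [tau tau0 tauA] : exists2 tau : R, 0 < tau & (tau%:E <= reach A)%E.
  move: rA; case: (reach A) => [r r0|_|//]; first by exists r.
  by exists 1; rewrite ?leey.
exists tau => // x q q1 q2 Aq xq xq1 xq2.
have [Ax|nAx] := pselect (A x).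
  have xE b : nearest A x b -> b = x.
    case=> _ /(_ _ Ax); rewrite subrr enorm0 => xb.
    have /enorm0_eq0/eqP : enorm (x - b) = 0 by apply/eqP; rewrite eq_le xb enorm_ge0.
    by rewrite subr_eq0 => /eqP.
  by rewrite (xE _ xq1) (xE _ xq2).
apply: contrapT => q12.
have : (reach A <= (enorm (q - x))%:E)%E.
  by apply: ereal_inf_lbound; exists q => //; exists x => //; split => //; exists q1, q2.
by move=> /(le_trans tauA); rewrite lee_fin enormC leNgt xq.
Qed.

(* The nearest point q of [p + t w] satisfies [|q - p| = o(t)] as t tends to 0,
   so [p + t w - q] is t w up to o(t); pass to the limit in [nearest_ball]. *)
Lemma normal_inequality (A : set 'rV[R]_d) (tau T : R) p w : closed A ->
  (forall x q q1 q2, A q -> enorm (x - q) < tau ->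
    nearest A x q1 -> nearest A x q2 -> q1 = q2) ->
  0 < T < tau -> A p ->
  (forall k : R, 0 < k -> exists2 rho : R, 0 < rho &
    forall q, A q -> enorm (q - p) < rho -> dot w (q - p) <= k * enorm (q - p)) ->
  forall z, A z -> 2 * T * dot w (z - p) <= enorm w * enorm (z - p) ^+ 2.
Proof.
move=> cA uniqA /andP[T0 Ttau] Ap tan z Az.
pose D := enorm (z - p); have D0 : 0 <= D by exact: enorm_ge0.
have w0 := enorm_ge0 w.
(* B collects the terms linear in [eta]: on the left from replacing [x - q] by [t *: w] and [z - q]
   by [z - p], on the right from bounding [enorm (z - q) ^+ 2]. *)
pose B := 2 * T * (enorm w + D) + enorm w * (2 * D + 1).
have B0 : 0 <= B by rewrite addr_ge0// !mulr_ge0 ?addr_ge0 ?mulr_ge0// ltW.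
suff H (eta : R) : 0 < eta <= 1 ->
    2 * T * dot w (z - p) <= enorm w * D ^+ 2 + eta * B.
  apply/ler_addgt0Pr => e e0.
  have eB0 : 0 < e + B by rewrite ltr_pwDl.
  have /H/le_trans : 0 < e / (e + B) <= 1.
    by rewrite divr_gt0//= ler_pdivrMr// mul1r lerDl.
  apply; rewrite lerD2l mulrAC ler_pdivrMr// ler_wpM2l ?(ltW e0)// lerDr ltW//.
move=> /andP[eta0 eta1].
have [rho rho0 rhoP] := tan (eta / 2) (divr_gt0 eta0 (ltr0n _ 2)).
have W0 : 0 < 2 * enorm w + 1 by rewrite ltr_wpDl// mulr_ge0.
(* Small enough that q stays within [rho] of p (two steps of length at most [t * enorm w]), that
   [enorm (x - q) <= T], and that [enorm (q - p) <= eta]; the added 1 makes the first bound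
   strict. *)
pose t := Num.min 1 (Num.min rho T / (2 * enorm w + 1)).
have t0 : 0 < t by rewrite lt_min ltr01 divr_gt0// lt_min rho0.
have t1 : t <= 1 by rewrite ge_min lexx.
have tW : t * (2 * enorm w + 1) <= Num.min rho T.
  by rewrite -ler_pdivlMr// ge_min lexx orbT.
have trho : t * (2 * enorm w + 1) <= rho.
  by rewrite (le_trans tW)// ge_min lexx.
have tT : t * (2 * enorm w + 1) <= T.
  by rewrite (le_trans tW)// ge_min lexx orbT.
have tw0 : 0 <= t * enorm w by rewrite mulr_ge0// ltW.
pose x := p + t *: w.
have xp : x - p = t *: w by rewrite /x addrAC subrr add0r.
have [q xq] : exists q, nearest A x q by apply: nearest_exists => //; exists p.
have [Aq qmin] := xq.
have xqt : enorm (x - q) <= t * enorm w.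
  by apply: le_trans (qmin _ Ap) _; rewrite xp enormZ gtr0_norm.
have xqE : x - q = t *: w - (q - p).
  by rewrite -xp opprB addrA subrK.
(* p competes with the nearest point q; together with the tangency bound on [dot w (q - p)] this
   gives [enorm (q - p) <= t * eta]. *)
have qp2 : enorm (q - p) ^+ 2 <= 2 * t * dot w (q - p).
  have : enorm (x - q) ^+ 2 <= (t * enorm w) ^+ 2.
    by rewrite ler_pXn2r// nnegrE enorm_ge0.
  rewrite xqE (enormB_sqr (t *: w)) enormZ (gtr0_norm t0) dotZl; lra.
have qprho : enorm (q - p) < rho.
  apply: le_lt_trans (enorm_triangle q x p) _; rewrite enormC xp enormZ gtr0_norm//.
  by apply: lt_le_trans trho; lra.
have qpt : enorm (q - p) <= t * eta.
  have qp0 := enorm_ge0 (q - p).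
  have [->|qpn0] := eqVneq (enorm (q - p)) 0; first by rewrite mulr_ge0// ltW.
  have qpgt0 : 0 < enorm (q - p) by rewrite lt0r qpn0.
  rewrite -(ler_pM2r qpgt0) -expr2; apply: le_trans qp2 _.
  have : t * dot w (q - p) <= t * (eta / 2 * enorm (q - p)).
    by rewrite ler_pM2l//; exact: rhoP.
  lra.
have key : 2 * T * dot (x - q) (z - q) <= enorm (x - q) * enorm (z - q) ^+ 2.
  have [xq0|xqn0] := eqVneq (enorm (x - q)) 0.
    by rewrite xq0 (enorm0_eq0 xq0) -(scale0r 0) dotZl !mul0r mulr0.
  apply: (nearest_ball cA uniqA xq) => //.
  rewrite lt0r xqn0 enorm_ge0/=; apply: le_trans xqt _.
  by apply: le_trans tT; rewrite ler_pM2l//; lra.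
move: key; have -> : z - q = (z - p) - (q - p) by rewrite opprB addrA subrK.
set e := q - p in qpt xqE *; set y := z - p in D D0 B B0 *.
have e0 := enorm_ge0 e.
have ye2 : enorm (y - e) ^+ 2 <= D ^+ 2 + eta * (2 * D + 1).
  have yeD : enorm (y - e) <= D + eta.
    rewrite (le_trans (enormD _ _))// enormN lerD2l (le_trans qpt)//.
    by rewrite ler_piMl// ltW.
  have : enorm (y - e) ^+ 2 <= (D + eta) ^+ 2.
    by rewrite ler_pXn2r// ?nnegrE ?enorm_ge0// addr_ge0// ltW.
  have : eta * eta <= eta * 1 by rewrite ler_pM2l.
  by rewrite !expr2; lra.
move=> key.
have {}key : 2 * T * dot (x - q) (y - e) <=
    (t * enorm w) * (D ^+ 2 + eta * (2 * D + 1)).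
  apply: le_trans key _; apply: ler_pM => //; first exact: enorm_ge0.
  exact: sqr_ge0.
have we : t * dot w e <= t * (enorm w * eta).
  rewrite ler_pM2l// (le_trans (dot_le _ _))// ler_wpM2l//.
  by rewrite (le_trans qpt)// ler_piMl// ltW.
have ey : dot e y <= t * eta * D.
  by rewrite (le_trans (dot_le _ _))// ler_wpM2r.
have xqy : t * dot w y - t * (enorm w * eta) - t * eta * D <= dot (x - q) (y - e).
  have dotexp (a b c : 'rV[R]_d) : dot (t *: a - b) (c - b) =
      t * dot a c - t * dot a b - dot b c + dot b b by rewrite !dotE; ring.
  by rewrite xqE dotexp; have := dotxx_ge0 e; lra.
have : 2 * T * (t * dot w y - t * (enorm w * eta) - t * eta * D) <=
    t * enorm w * (D ^+ 2 + eta * (2 * D + 1)).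
  by apply: le_trans key; rewrite ler_wpM2l// mulr_ge0// ltW.
by move=> h; rewrite -(ler_pM2l t0) /B; lra.
Qed.

Lemma mulmx_bound (m n : nat) (B : 'M[R]_(m, n)) :
  exists2 C : R, 0 < C & forall u : 'rV[R]_m, `|u *m B| <= C * `|u|.
Proof.
exists (m%:R * `|B| + 1); first by rewrite ltr_wpDl// mulr_ge0.
move=> u; rewrite [leLHS]/Num.norm/= mx_normrE; apply/bigmax_leP; split => /=.
  by rewrite mulr_ge0// addr_ge0// mulr_ge0.
move=> [i j] _ /=; rewrite mxE (ord1 i).
apply: (@le_trans _ _ (m%:R * `|B| * `|u|)); last by rewrite ler_wpM2r// lerDl.
apply: le_trans (ler_norm_sum _ _ _) _.
rewrite -mulrA mulr_natl -[X in _ *+ X]card_ord -sumr_const; apply: ler_sum => k _.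
rewrite normrM mulrC ler_pM ?coord_le_norm//.
rewrite [leRHS]/Num.norm/= mx_normrE.
by apply/bigmax_geP; right => /=; exists (k, j).
Qed.

Lemma dot_mulmx (m : nat) w (u : 'rV[R]_m) (J : 'M[R]_(m, d)) :
  w *m J^T = 0 -> dot w (u *m J) = 0.
Proof.
move=> wJ; have -> : dot w (u *m J) = (w *m J^T *m u^T) ord0 ord0.
  by rewrite -mulmxA -trmx_mul mxE; apply: eq_bigr => i _; rewrite !mxE.
by rewrite wJ mul0mx mxE.
Qed.

(** [w *m J^T = 0] says that w is orthogonal to the rows of J, which span the tangent space. By
    continuity of [psi], points q of M near p are [phi (v0 + u)] with u small, so [q - p] is
    [u *m J] up to o(u), and a right inverse of J bounds u by [q - p]. *)
Lemma submanifold_tangent (m : nat) (M : set 'rV[R]_d) p :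
  embedded_submanifold m M -> M p ->
  exists2 J : 'M[R]_(m, d), row_free J &
    forall w, w *m J^T = 0 -> forall k : R, 0 < k -> exists2 rho : R, 0 < rho &
    forall q, M q -> enorm (q - p) < rho -> dot w (q - p) <= k * enorm (q - p).
Proof.
move=> sM Mp; have [U [V [phi [psi [[oU Up] [oV VMU] dphi Jfree [phiK cpsi]]]]]] := sM p Mp.
have [v0 Vv0 phiv0] : (phi @` V) p by rewrite VMU.
have psip : psi p = v0 by rewrite -phiv0 phiK ?inE.
set J := jacobian phi v0.
exists J => [|w wJ k k0]; first exact: Jfree.
have /row_freeP[B JB] := Jfree _ Vv0.
have [C C0 CP] := mulmx_bound B.
(* The first bound lets the error [o], multiplied by C, be absorbed into half of the norm of u; the
   second yields the factor k at the end. *)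
pose e := Num.min (2 * C)^-1 (k / (2 * C * d%:R * enorm w + 1)).
have W0 : 0 < 2 * C * d%:R * enorm w + 1.
  by rewrite ltr_wpDl// !mulr_ge0 ?enorm_ge0// ltW.
have e0 : 0 < e by rewrite lt_min invr_gt0 mulr_gt0//= divr_gt0.
have eC : e * (2 * C) <= 1.
  by rewrite -ler_pdivlMr ?mulr_gt0// mul1r ge_min lexx.
have ek : e * (2 * C * d%:R * enorm w) <= k.
  rewrite (@le_trans _ _ (e * (2 * C * d%:R * enorm w + 1)))//.
    by rewrite ler_pM2l// lerDl.
  by rewrite -ler_pdivlMr// ge_min lexx orbT.
have [eta eta0 etaP] : exists2 eta : R, 0 < eta & forall u : 'rV[R]_m,
    `|u| < eta -> `|phi (v0 + u) - p - u *m J| <= e * `|u|.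
  have [df _] := dphi _ Vv0.
  have /eqaddoP/(_ _ e0) := diff_locally df.
  move=> /(@nbhs_normP _ _ (0 : 'rV[R]_m))[eta /= eta0 etaP].
  exists eta => // u ueta; have := etaP u; rewrite /= sub0r normrN => /(_ ueta).
  rewrite /J /jacobian mul_rV_lin1 /= -phiv0 !fctE /shift/= (addrC u).
  by rewrite opprD addrA.
have [rho1 rho10 rho1P] : exists2 rho : R, 0 < rho & forall q, (M `&` U) q ->
    enorm (q - p) < rho -> `|psi q - v0| < eta.
  have : psi @ within (M `&` U) (nbhs p) --> v0.
    by rewrite -psip; have /subspace_continuousP := cpsi; apply.
  move=> /(@cvgrPdist_lt _ _ _ _ _ psi v0)/(_ _ eta0).
  move=> /nbhs_eball[rho rho0 rhoP]; exists rho => // q MUq qp.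
  by rewrite distrC; exact: rhoP qp MUq.
have [rho2 rho20 rho2P] := nbhs_eball (open_nbhs_nbhs (conj oU Up)).
exists (Num.min rho1 rho2); first by rewrite lt_min rho10.
move=> q Mq; rewrite lt_min => /andP[qp1 qp2].
have MUq : (M `&` U) q by split => //; exact: rho2P.
have [v Vv phiv] : (phi @` V) q by rewrite VMU.
have psiq : psi q = v by rewrite -phiv phiK ?inE.
have := rho1P _ MUq qp1; rewrite psiq; set u := v - v0 => ueta.
have := etaP _ ueta; have -> : v0 + u = v by rewrite addrC subrK.
rewrite phiv.
set o := q - p - u *m J => oe.
have qpE : q - p = u *m J + o by rewrite /o [RHS]addrC subrK.
have uE : u = (q - p - o) *m B by rewrite {1}qpE addrK -mulmxA JB mulmx1.
have ub : `|u| <= 2 * C * `|q - p|.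
  have : `|u| <= C * (`|q - p| + `|o|).
    by rewrite {1}uE (le_trans (CP _))// ler_pM2l// ler_normB.
  have : C * `|o| <= C * (e * `|u|) by rewrite ler_pM2l.
  have : (e * (2 * C)) * `|u| <= 1 * `|u| by rewrite ler_wpM2r.
  by lra.
rewrite {1}qpE dotDr dot_mulmx// add0r (le_trans (dot_le _ _))//.
have ow : enorm w * enorm o <= enorm w * (d%:R * (e * (2 * C * enorm (q - p)))).
  rewrite ler_wpM2l ?enorm_ge0// (le_trans (enorm_le_norm _))// ler_wpM2l//.
  rewrite (le_trans oe)// ler_pM2l// (le_trans ub)// ler_pM2l ?mulr_gt0//.
  exact: norm_le_enorm.
apply: le_trans ow _.
have := ler_wpM2r (enorm_ge0 (q - p)) ek; lra.
Qed.

End tangent.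

(** * Charts over coordinate planes *)

Section maximal_minor.
Context {F : realFieldType} {m d : nat}.

(** Laplace expansion along column i, whose cofactors are unaffected when that column is replaced by
    column j of J. *)
Lemma adj_mul_colsub (J : 'M[F]_(m, d)) (f : 'I_m -> 'I_d) i j :
  (\adj (colsub f J) *m J) i j = \det (colsub (fun k => if k == i then j else f k) J).
Proof.
rewrite (expand_det_col _ i) mxE; apply: eq_bigr => k _.
rewrite !mxE eqxx mulrC; congr (_ * _); congr (_ * \det _).
by apply/matrixP => a b; rewrite !mxE eq_sym (negbTE (neq_lift _ _)).
Qed.

(* By Cramer's rule the entries of [K *m J] are ratios of maximal minors of J. *)
Lemma maximal_minor (J : 'M[F]_(m, d)) : row_free J ->
  exists (f : 'I_m -> 'I_d) (K : 'M[F]_m),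
    colsub f (K *m J) = 1%:M /\ forall i j, `|(K *m J) i j| <= 1.
Proof.
move=> freeJ; have fullJ : row_full J^T by rewrite /row_full mxrank_tr.
(* All maps f compete, injective or not, because exchanging one index in Cramer's rule may repeat a
   coordinate. *)
pose minor (f : {ffun 'I_m -> 'I_d}) := `|\det (colsub f J)|.
have [f0 f0_gt0] : exists f, 0 < minor f.
  exists (finfun (fullrankfun fullJ)); rewrite normr_gt0 -det_tr -unitfE.
  rewrite -[_ \is a _]/(_ \in unitmx) (_ : _^T = rowsub (fullrankfun fullJ) J^T).
    exact: fullrowsub_unit.
  by apply/matrixP => i j; rewrite !mxE ffunE.
case: (arg_maxP minor (erefl : xpredT f0)) => f _ fmax.
have f_gt0 : 0 < minor f by apply: lt_le_trans f0_gt0 (fmax _ _).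
have Au : colsub f J \in unitmx by rewrite unitmxE unitfE -normr_gt0.
exists f, (invmx (colsub f J)); split; first by rewrite -mulmx_colsub mulVmx.
move=> i j; rewrite /invmx Au -scalemxAl mxE adj_mul_colsub normrM normrV.
  rewrite mulrC ler_pdivrMr// mul1r.
  apply: le_trans (fmax [ffun k => if k == i then j else f k] isT).
  by rewrite /minor le_eqVlt; apply/orP; left; apply/eqP; congr `|\det _|;
    apply/matrixP => a b; rewrite !mxE ffunE.
by rewrite -unitmxE.
Qed.

End maximal_minor.

Section graph_chart.
Context {R : realType} {d : nat}.
Implicit Types (x y z p w : 'rV[R]_d).

(** [u *m (J *m J^T) = 0] makes [u *m J] orthogonal to itself, and J is injective on row vectors. *)
Lemma gram_unit m (J : 'M[R]_(m, d)) : row_free J -> J *m J^T \in unitmx.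
Proof.
move=> freeJ; rewrite -row_free_unit; apply/row_freeP.
have inj (u : 'rV[R]_m) : u *m (J *m J^T) = 0 -> u = 0.
  move=> u0; have : dot (u *m J) (u *m J) = 0.
    by apply: dot_mulmx; rewrite -mulmxA.
  rewrite -enorm_sqr => /eqP; rewrite sqrf_eq0 => /eqP/enorm0_eq0 uJ.
  by apply: (row_free_inj freeJ); rewrite uJ mul0mx.
suff : row_free (J *m J^T) by move/row_freeP.
rewrite -kermx_eq0; apply/eqP/row_matrixP => i; rewrite row0; apply: inj.
by rewrite -row_mul mulmx_ker row0.
Qed.

(** Orthogonal projection onto the row space, by the normal equations. *)
Lemma orthogonal_decomposition m (J : 'M[R]_(m, d)) z : row_free J ->
  exists (s : 'rV[R]_m) w, z = s *m J + w /\ w *m J^T = 0.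
Proof.
move=> freeJ; pose s := z *m J^T *m invmx (J *m J^T).
exists s, (z - s *m J); split; first by rewrite addrC subrK.
by rewrite mulmxBl -(mulmxA s) mulmxKV ?gram_unit// subrr.
Qed.

(* Near each of its points p, A is a C-Lipschitz graph over m coordinates f
   depending on p; [f] may repeat a coordinate, which does no harm. *)
Definition graph_charts (m : nat) (A : set 'rV[R]_d) (r0 C : R) :=
  forall p, A p -> exists f : 'I_m -> 'I_d, forall z, A z -> enorm (z - p) <= r0 ->
    forall e : R, 0 <= e -> (forall i, `|(z - p) ord0 (f i)| <= e) ->
    enorm (z - p) <= C * e.

(** Write [z - p] as [s *m (K *m J) + w] with w normal. The columns f of [K *m J] form the identity,
    so s is read off from the coordinates f of [z - p] and w; the hypothesis makes w quadratically
    small, and the radius is such that the terms in w total at most half of [enorm (z - p)]. *)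
Lemma graph_chart m (J : 'M[R]_(m, d)) (A : set 'rV[R]_d) p (T : R) :
  0 < T -> row_free J ->
  (forall w, w *m J^T = 0 -> forall z, A z ->
    2 * T * dot w (z - p) <= enorm w * enorm (z - p) ^+ 2) ->
  exists f : 'I_m -> 'I_d, forall z, A z ->
    enorm (z - p) <= T / (d%:R * (m%:R + 1) + 1) ->
    forall e : R, 0 <= e -> (forall i, `|(z - p) ord0 (f i)| <= e) ->
    enorm (z - p) <= (2 * d%:R * m%:R + 1) * e.
Proof.
move=> T0 freeJ nJ; have [f [K [KJf KJ1]]] := maximal_minor freeJ.
exists f => z Az zT e e0 ze; set y := z - p in zT ze *.
(* K is invertible, so J and [K *m J] have the same normal vectors. *)
have Ku : K \in unitmx.
  have : row_free (colsub f (K *m J)) by rewrite KJf row_free_unit unitmx1.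
  rewrite -mulmx_colsub -row_free_unit -!kermx_eq0 => /eqP k0.
  apply/eqP; apply/row_matrixP => i; rewrite row0.
  have : (row i (kermx K) <= kermx (K *m colsub f J))%MS.
    by apply/sub_kermxP; rewrite mulmxA -row_mul mulmx_ker row0 mul0mx.
  by rewrite k0 submx0 => /eqP.
have freeKJ : row_free (K *m J).
  by rewrite /row_free eqmxMfull ?row_full_unit.
have [s [w [yE wKJ]]] := orthogonal_decomposition y freeKJ.
have wJ : w *m J^T = 0.
  have : w *m J^T *m K^T = 0 by rewrite -mulmxA -trmx_mul.
  move=> /(congr1 (mulmxr (invmx K^T))) /=.
  by rewrite mulmxK ?unitmx_tr// mul0mx.
have w0 := enorm_ge0 w; have y0 := enorm_ge0 y.
have wy : 2 * T * enorm w <= enorm y ^+ 2.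
  have [->|wn0] := eqVneq (enorm w) 0; first by rewrite mulr0 sqr_ge0.
  have wgt0 : 0 < enorm w by rewrite lt0r wn0.
  have := nJ _ wJ _ Az; rewrite -/y {1}yE dotDr dot_mulmx// add0r -enorm_sqr.
  by rewrite expr2 mulrA (mulrC (enorm w)) ler_pM2r.
have sE i : s ord0 i = y ord0 (f i) - w ord0 (f i).
  have : (s *m colsub f (K *m J)) ord0 i = (s *m (K *m J)) ord0 (f i).
    by rewrite mulmx_colsub mxE.
  by rewrite KJf mulmx1 => ->; rewrite yE [in RHS]mxE addrK.
have sb i : `|s ord0 i| <= e + enorm w.
  by rewrite sE (le_trans (ler_normB _ _))// lerD// coord_le_enorm.
have yb : enorm y <= d%:R * (m%:R * (e + enorm w) + enorm w).
  apply: enorm_le_coord => j; rewrite yE mxE (le_trans (ler_normD _ _))// lerD//.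
    rewrite mxE (le_trans (ler_norm_sum _ _ _))//.
    rewrite mulr_natl -[X in _ *+ X]card_ord -sumr_const; apply: ler_sum => k _.
    by rewrite normrM -[leRHS]mulr1 ler_pM.
  exact: coord_le_enorm.
have D0 : 0 < d%:R * (m%:R + 1) + 1 :> R by rewrite ltr_wpDl// mulr_ge0// addr_ge0.
have wy2 : 2 * (d%:R * (m%:R + 1)) * enorm w <= enorm y.
  have h : (d%:R * (m%:R + 1) + 1) * enorm y <= T by rewrite mulrC -ler_pdivlMr.
  rewrite -(ler_pM2l T0).
  have h1 : d%:R * (m%:R + 1) * (2 * T * enorm w) <= d%:R * (m%:R + 1) * enorm y ^+ 2.
    by rewrite ler_wpM2l// mulr_ge0// addr_ge0.
  have : (d%:R * (m%:R + 1) + 1) * enorm y * enorm y <= T * enorm y by rewrite ler_wpM2r.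
  by have := sqr_ge0 (enorm y); move: h1; rewrite expr2; lra.
lra.
Qed.

(** T is taken strictly below [tau]. The Jacobian depends on p, but the radius and the constant of
    [graph_chart] involve only T, d and m. *)
Lemma submanifold_graph_charts m (M : set 'rV[R]_d) : closed M ->
  embedded_submanifold m M -> (0 < reach M)%E ->
  exists r0 C : R, [/\ 0 < r0, 0 < C & graph_charts m M r0 C].
Proof.
move=> cM sM /reach_nearest_uniq[tau tau0 uniqM].
have T0 : 0 < tau / 2 by rewrite divr_gt0.
exists (tau / 2 / (d%:R * (m%:R + 1) + 1)), (2 * d%:R * m%:R + 1); split.
- by rewrite divr_gt0// ltr_wpDl// mulr_ge0// addr_ge0.
- by rewrite ltr_wpDl// !mulr_ge0.
move=> p Mp; have [J freeJ tanJ] := submanifold_tangent sM Mp.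
apply: (graph_chart T0 freeJ) => w wJ.
by apply: (normal_inequality cM uniqM) => //; [lra|exact: tanJ].
Qed.

Lemma full_graph_charts : graph_charts d [set: 'rV[R]_d] 1 (d%:R + 1).
Proof.
move=> p _; exists id => z _ _ e e0 ze.
by apply: le_trans (enorm_le_coord ze) _; rewrite ler_wpM2r// lerDl.
Qed.

(* One set for each f and each cell of a grid of step 2 r / N in the coordinates
   f; the sets with index at least d^m N^m are empty. *)
Lemma graph_charts_cover m (A : set 'rV[R]_d) (r0 C r : R) x (N : nat) :
  graph_charts m A r0 C -> 0 < r -> 2 * r <= r0 -> (0 < N)%N ->
  exists S : nat -> set 'rV[R]_d,
  [/\ A `&` eball x r `<=` \bigcup_k S k,
      forall k, (d ^ m * N ^ m <= k)%N -> S k = set0 &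
      forall k y z, S k y -> S k z -> enorm (y - z) <= 2 * C * r / N%:R].
Proof.
move=> chartA r_gt0 rr0 N0; pose I := ({ffun 'I_m -> 'I_d} * {ffun 'I_m -> 'I_N})%type.
have cardI : #|{: I}| = (d ^ m * N ^ m)%N by rewrite card_prod !card_ffun !card_ord.
pose h : R := 2 * r / N%:R.
have h0 : 0 < h by rewrite divr_gt0 ?mulr_gt0// ltr0n.
(* The Lipschitz property with coordinates [i.1] is part of the piece, so that any of its points may
   serve as the base point. The shift by r places the coordinates between 0 and [2 * r], hence the
   cell indices below N. *)
pose piece (i : I) : set 'rV[R]_d := [set y | [/\ A y, enorm (y - x) < r,
  forall z, A z -> enorm (z - y) <= r0 -> forall e : R, 0 <= e ->
    (forall k, `|(z - y) ord0 (i.1 k)| <= e) -> enorm (z - y) <= C * e &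
  forall k, (i.2 k)%:R * h <= y ord0 (i.1 k) - x ord0 (i.1 k) + r <= (i.2 k).+1%:R * h]].
exists (fun k => if insub k is Some i then piece (enum_val (i : 'I_#|{: I}|)) else set0).
split.
- move=> y [Ay yx]; have [f fP] := chartA _ Ay.
  have yxk k : 0 <= (y ord0 (f k) - x ord0 (f k) + r) / h < N%:R.
    have : `|y ord0 (f k) - x ord0 (f k)| < r.
      by apply: le_lt_trans yx; have := coord_le_enorm (y - x) (f k); rewrite !mxE.
    rewrite ltr_norml => /andP[h1 h2]; rewrite divr_ge0 ?(ltW h0)//=; last lra.
    rewrite ltr_pdivrMr// /h mulrCA mulfV ?mulr1 ?pnatr_eq0 -?lt0n//; lra.
  have truncN k : (Num.truncn ((y ord0 (f k) - x ord0 (f k) + r) / h) < N)%N.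
    by have /andP[? ?] := yxk k; rewrite truncn_lt_nat.
  pose i : I := ([ffun k => f k], [ffun k => Ordinal (truncN k)]).
  exists (enum_rank i) => //; rewrite valK enum_rankK; split => //=.
    by move=> z Az zy e e0 H; apply: fP => // k; have := H k; rewrite !ffunE.
  move=> k; rewrite !ffunE /=; have /andP[t0 _] := yxk k.
  have /andP[? /ltW ?] := truncn_itv t0.
  by rewrite -(ler_pdivlMr _ _ h0) -(ler_pdivrMr _ _ h0); apply/andP.
- by move=> k; rewrite -cardI leqNgt => kI; rewrite insubN.
- move=> k y z; case: insubP => [i _ _|//] [Ay yx _ yk] [Az zx Pz zk].
  have -> : 2 * C * r / N%:R = C * h by rewrite /h; ring.
  apply: Pz => //; [|exact: ltW|].
    by apply: le_trans rr0; have := enorm_triangle y x z; rewrite (enormC x z); lra.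
  move=> j; have := yk j; have := zk j;
    rewrite !mxE -[((enum_val i).2 j).+1]addn1 natrD mulrDl mul1r.
  by move=> /andP[? ?] /andP[? ?]; rewrite ler_norml; apply/andP; split; lra.
Qed.

End graph_chart.

(** * Outer measures and Borel sets *)

Section covering_outer_measure.
Context {R : realType} {T I : Type} (S : I -> set T) (c : I -> \bar R).
Hypothesis c_ge0 : forall i, (0 <= c i)%E.
Local Open Scope ereal_scope.

(** Common form of [hausdorff_pre], whose covers are indexed by sets of bounded diameter, and of
    [lebesgue_rV], whose covers are indexed by pairs of corners. *)
Definition covering_cost (adm : set I) (A : set T) : \bar R :=
  ereal_inf [set \sum_(0 <= k <oo) c (F k) |
    F in [set F : nat -> I | (forall k, adm (F k)) /\ A `<=` \bigcup_k S (F k)]].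

Lemma covering_cost_ge0 adm A : 0 <= covering_cost adm A.
Proof. by apply: le_ereal_inf_tmp => _ [F _ <-]; exact: nneseries_ge0. Qed.

(** Near-optimal covers with errors [e / 2 ^ n.+1] are merged into one through a bijection between
    [nat] and [nat * nat]. *)
Lemma covering_cost_sigma_subadditive adm :
  sigma_subadditive (covering_cost adm).
Proof.
move=> A; have [[i ioo]|] := pselect (exists i, covering_cost adm (A i) = +oo).
  rewrite (eseries_pinfty _ _ ioo) ?leey// => n _.
  by rewrite -ltNye (lt_le_trans _ (covering_cost_ge0 _ _)).
rewrite -forallNE => Aoo; apply/lee_addgt0Pr => e e0.
rewrite (le_trans _ (epsilon_trick _ _ (ltW e0)))//; last first.
  by move=> n; exact: covering_cost_ge0.
have /choice[G PG] : forall n, exists B : nat -> I,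
    [/\ forall k, adm (B k), A n `<=` \bigcup_k S (B k) &
    \sum_(k <oo) c (B k) <= covering_cost adm (A n) + (e / (2 ^ n.+1)%:R)%:E].
  move=> n; have fin : covering_cost adm (A n) \is a fin_num.
    by rewrite ge0_fin_numE ?covering_cost_ge0// lt_neqAle leey andbT; exact/eqP.
  have en : (0 < e / (2 ^ n.+1)%:R)%R by rewrite divr_gt0// ltr0n expn_gt0.
  have [_ [B [admB AB] <-] /ltW cB] := lb_ereal_inf_adherent en fin.
  by exists B.
have /card_esym/ppcard_eqP[f] := card_nat2.
apply: (@le_trans _ _ (\sum_(k <oo) c (G (f k).1 (f k).2))).
  apply: ereal_inf_lbound; exists (fun k => G (f k).1 (f k).2) => //.
  split=> [k|t [i _]]; first by case: (PG (f k).1).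
  have [_ AG _] := PG i; move=> /AG[j _ Gij].
  by exists (f^-1%FUN (i, j)) => //=; rewrite invK ?inE.
rewrite nneseries_esumT//.
rewrite -(reindex_esum _ [set: nat * nat] f (fun ij => c (G ij.1 ij.2)))//.
rewrite (_ : setT = [set: nat] `*`` (fun=> [set: nat])); last first.
  by apply/seteqP; split.
rewrite -(@esum_esum _ _ _ _ (fun=> setT) (fun i j => c (G i j)))//.
rewrite -(@nneseries_esumT _ (fun i => \esum_(j in setT) c (G i j))); last first.
  by move=> i; apply: esum_ge0 => *; exact: c_ge0.
apply: lee_nneseries => [n _ _|n _]; first by apply: esum_ge0 => *; exact: c_ge0.
by rewrite -nneseries_esumT//; case: (PG n).
Qed.

Lemma le_covering_cost adm A B : A `<=` B ->
  covering_cost adm A <= covering_cost adm B.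
Proof.
move=> AB; apply: ereal_inf_le_tmp => _ [F [admF BF] <-].
by exists F => //; split=> //; exact: subset_trans BF.
Qed.

End covering_outer_measure.

Section slab_separation.
Context {R : realType} {d : nat}.
Variable mu : {outer_measure set 'rV[R]_d -> \bar R}.
Hypothesis mu_separated : forall (i : 'I_d) (c c' : R) (A B : set 'rV[R]_d),
  c < c' -> A `<=` [set x | x ord0 i <= c] -> B `<=` [set x | c' <= x ord0 i] ->
  (mu A + mu B <= mu (A `|` B))%E.

(* Caratheodory's criterion for metric outer measures: the slabs
   [a k <= x_i < a (k - 1)] with k of a given parity are mutually separated, so
   their measures are summable and the part of X close to the half-space is
   negligible. *)
Lemma caratheodory_halfspace (i : 'I_d) (c : R) :
  mu.-caratheodory [set x : 'rV[R]_d | x ord0 i <= c].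
Proof.
apply: le_caratheodory_measurable => X; set H := [set x | _].
have [->|Xoo] := eqVneq (mu X) +oo%E; first exact: leey.
have Xfin : mu X \is a fin_num.
  by rewrite ge0_fin_numE ?outer_measure_ge0// lt_neqAle Xoo leey.
pose a k : R := c + k.+1%:R^-1.
have a_gt k : c < a k by rewrite ltrDl invr_gt0.
have a_lt k : a k.+1 < a k by rewrite ltrD2l ltf_pV2 ?posrE// ltr_nat.
have a_le j k : (j <= k)%N -> a k <= a j.
  by move=> jk; rewrite lerD2l lef_pV2 ?posrE// ler_nat.
pose A k := X `&` [set x | a k <= x ord0 i].
pose Q k := if k is k'.+1 then X `&` [set x | a k <= x ord0 i < a k'] else A 0%N.
have QA k : Q k `<=` [set x | a k <= x ord0 i].
  by case: k => [|k] x [_] //= /andP[].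
have QX k : Q k `<=` X by case: k => [|k] x [].
have half b n : (\sum_(k < n) mu (Q (k.*2 + b)%N) <= mu X)%E.
  pose E n := \big[setU/set0]_(k < n) Q (k.*2 + b)%N.
  have EE j : E j = \bigcup_(k in `I_j) Q (k.*2 + b)%N.
    by rewrite (bigcup_mkord j (fun k => Q (k.*2 + b)%N)).
  have EX j : E j `<=` X by move=> x; rewrite EE => -[k _ /QX].
  apply: (@le_trans _ _ (mu (E n))); last exact/le_outer_measure/EX.
  elim: n => [|n ih]; first by rewrite big_ord0 outer_measure_ge0.
  rewrite big_ord_recr /= /E big_ord_recr /= -/(E n).
  case: n ih => [|n] ih.
    by rewrite /E !big_ord0 add0e set0U.
  apply: (@le_trans _ _ (mu (E n.+1) + mu (Q (n.+1.*2 + b)%N))%E).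
    by rewrite leeD2r.
  rewrite addeC setUC.
  apply: (mu_separated (i := i) (c := a (n.*2 + b).+1) (c' := a (n.*2 + b)%N)) => //.
   by move=> x; rewrite doubleS !addSn => -[_ /= /andP[_ /ltW]].
  move=> x; rewrite EE => -[k /= kn] /QA /=; apply: le_trans.
  by apply: a_le; rewrite leq_add2r leq_double -ltnS.
have sumQ n : (\sum_(k < n) mu (Q k) <= mu X + mu X)%E.
  apply: (@le_trans _ _ (\sum_(k < n.*2) mu (Q k))%E).
    rewrite -!(big_mkord xpredT (mu \o Q)); apply: lee_sum_nneg_natr.
      by move=> ? _ _; exact: outer_measure_ge0.
    by rewrite -addnn leq_addr.
  have -> : (\sum_(k < n.*2) mu (Q k) =
      \sum_(k < n) mu (Q (k.*2 + 0)%N) + \sum_(k < n) mu (Q (k.*2 + 1)%N))%E.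
    elim: n => [|n ih]; first by rewrite !big_ord0 adde0.
    rewrite doubleS !big_ord_recr/= ih addn0 addn1.
    by rewrite -!addeA; congr (_ + _)%E; rewrite addeCA.
  exact: leeD.
have Qoo : (\sum_(0 <= k <oo) mu (Q k) < +oo)%E.
  apply: (@le_lt_trans _ _ (mu X + mu X)%E); last by rewrite ltey_eq fin_numD Xfin.
  apply: lime_le; first by apply: is_cvg_nneseries => *; exact: outer_measure_ge0.
  by apply: nearW => n; rewrite big_mkord.
have tail := nneseries_tail_cvg Qoo (fun k _ => outer_measure_ge0 mu (Q k)).
apply/lee_addgt0Pr => e e0.
have [n tailn] : exists n, (\sum_(n.+1 <= k <oo) mu (Q k) <= e%:E)%E.
  move/fine_cvgP : tail => [[N1 _ fin] /cvgrPdist_le/(_ _ e0)[N2 _ small]].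
  exists (maxn N1 N2); have := small (maxn N1 N2).+1 (leqW (leq_maxr _ _)).
  rewrite /= sub0r normrN => h; rewrite -(fineK (fin _ (leqW (leq_maxl N1 N2)))).
  by rewrite lee_fin (le_trans (ler_norm _) h).
(* A point beyond c but below [a n] lies in [Q k] for the least k with [a k <= x ord0 i], and this k
   exceeds n. *)
have XH : (mu (X `&` ~` H) <= mu (A n) + \sum_(n.+1 <= k <oo) mu (Q k))%E.
  apply: (@le_trans _ _ (mu (A n `|` \bigcup_(k in ~` `I_n.+1) Q k))).
    apply: le_outer_measure => x [Xx /= /negP]; rewrite -ltNge => cx.
    have [anx|xan] := leP (a n) (x ord0 i); [by left|right].
    have ex : exists k, a k <= x ord0 i.
      exists (Num.truncn (x ord0 i - c)^-1); rewrite -lerBrDl.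
      rewrite invf_ple ?posrE ?subr_gt0//; exact/ltW/truncnS_gt.
    case: (ex_minnP ex) => [[|k] ak kmin].
      by move: xan; rewrite ltNge (le_trans _ ak)// a_le.
    exists k.+1 => /=.
      by apply/negP; rewrite -leqNgt ltnS leqNgt; apply: contraL xan => kn;
        rewrite -leNgt (le_trans _ ak)// a_le// ltnW.
    split=> //=; rewrite ak/= ltNge; apply/negP => /kmin.
    by rewrite ltnn.
  apply: (le_trans (outer_measureU2 _ _ _)); rewrite leeD2l//.
  exact: outer_measure_sigma_subadditive_tail.
apply: (@le_trans _ _ (mu (X `&` H) + (mu (A n) + e%:E))%E).
  by rewrite leeD2l// (le_trans XH)// leeD2l.
rewrite addeA leeD2r//; apply: (@le_trans _ _ (mu (X `&` H `|` A n))).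
  by apply: (mu_separated (i := i) (a_gt n)) => x [].
by apply: le_outer_measure => x [[]|[]].
Qed.

End slab_separation.

Section borel_caratheodory.
Context {R : realType} {d : nat}.
Variable mu : {outer_measure set 'rV[R]_d -> \bar R}.
Hypothesis mu_separated : forall (i : 'I_d) (c c' : R) (A B : set 'rV[R]_d),
  c < c' -> A `<=` [set x | x ord0 i <= c] -> B `<=` [set x | c' <= x ord0 i] ->
  (mu A + mu B <= mu (A `|` B))%E.

(** Half-open, so that each box is a finite intersection of differences of half-spaces
    [x ord0 i <= c]; rational, so that countably many fill any open set. *)
Let rational_box (pq : 'rV[rat]_d * 'rV[rat]_d) : set 'rV[R]_d :=
  [set x | forall i, ratr (pq.1 ord0 i) < x ord0 i <= ratr (pq.2 ord0 i)].

Let caratheodory_rational_box pq : mu.-caratheodory (rational_box pq).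
Proof.
have H (s : seq 'I_d) : mu.-caratheodory [set x : 'rV[R]_d |
    forall i, i \in s -> ratr (pq.1 ord0 i) < x ord0 i <= ratr (pq.2 ord0 i)].
  elim: s => [|i s ih].
    rewrite (_ : [set x | _] = ~` set0).
      exact/caratheodory_measurable_setC/caratheodory_measurable_set0.
    by apply/seteqP; split=> [x _ []//|x _ i]; rewrite in_nil.
  rewrite (_ : [set x | _] = ([set x : 'rV[R]_d | x ord0 i <= ratr (pq.2 ord0 i)] `\`
      [set x : 'rV[R]_d | x ord0 i <= ratr (pq.1 ord0 i)]) `&` [set x : 'rV[R]_d |
    forall i, i \in s -> ratr (pq.1 ord0 i) < x ord0 i <= ratr (pq.2 ord0 i)]).
    apply: caratheodory_measurable_setI => //.
    by apply: caratheodory_measurable_setD; exact: caratheodory_halfspace.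
  apply/seteqP; split=> [x xs|x [[/= x1 /negP x2] xs] j].
    split; last by move=> j js; apply: xs; rewrite inE js orbT.
    have /andP[x1 x2] := xs i (mem_head _ _).
    by split=> //=; apply/negP; rewrite -ltNge.
  by rewrite inE => /orP[/eqP ->|/xs//]; rewrite x1 ltNge x2.
have := H (enum 'I_d); congr (mu.-caratheodory _).
by apply/seteqP; split=> x /= h i; [apply: h; rewrite mem_enum|move=> _; exact: h].
Qed.

Let open_rational_boxes (U : set 'rV[R]_d) x : open U -> U x ->
  exists pq, rational_box pq x /\ rational_box pq `<=` U.
Proof.
move=> oU Ux; have [e e0 eU] := nbhs_eball (open_nbhs_nbhs (conj oU Ux)).
pose r := e / (d%:R + 1).
have r0 : 0 < r by rewrite divr_gt0// ltr_wpDl.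
have /choice[p pP] : forall i, exists q : rat, x ord0 i - r < ratr q < x ord0 i.
  move=> i; have [|q] := @rat_in_itvoo R (x ord0 i - r) (x ord0 i).
    by rewrite gtrBl.
  by rewrite in_itv /=; exists q.
have /choice[q qP] : forall i, exists q : rat, x ord0 i < ratr q < x ord0 i + r.
  move=> i; have [|q] := @rat_in_itvoo R (x ord0 i) (x ord0 i + r).
    by rewrite ltrDl.
  by rewrite in_itv /=; exists q.
exists (\row_i p i, \row_i q i); split=> [i|y yb].
  by rewrite /= !mxE; have /andP[_ ->] := pP i; have /andP[/ltW] := qP i.
apply: eU; apply: (@le_lt_trans _ _ (d%:R * r)); last first.
  by rewrite /r mulrCA gtr_pMr// ltr_pdivrMr ?ltr_wpDl// mul1r ltrDl.
apply: enorm_le_coord => i; have := yb i; have := pP i; have := qP i.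
rewrite /= !mxE => /andP[? ?] /andP[? ?] /andP[? ?].
by rewrite ler_norml; apply/andP; split; lra.
Qed.

Lemma borel_caratheodory (A : set (borel_rV R d)) :
  measurable A -> mu.-caratheodory A.
Proof.
apply: smallest_sub.
  split; first exact: caratheodory_measurable_set0.
    by move=> B mB; rewrite setTD; exact: caratheodory_measurable_setC.
  by move=> B mB; exact: caratheodory_measurable_bigcup.
move=> U oU.
pose F k := if unpickle k is Some pq then
  if pselect (rational_box pq `<=` U) then rational_box pq else set0 else set0.
rewrite (_ : U = \bigcup_k F k).
  apply: caratheodory_measurable_bigcup => k; rewrite /F.
  case: unpickle => [pq|]; last exact: caratheodory_measurable_set0.
  by case: pselect => ? //=; exact: caratheodory_measurable_set0.
apply/seteqP; split=> [x Ux|x [k _]]; rewrite /F.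
  have [pq [xpq pqU]] := open_rational_boxes oU Ux.
  by exists (pickle pq) => //; rewrite pickleK; case: pselect.
by case: unpickle => // pq; case: pselect => pqU // /pqU.
Qed.

(** Equality with a bundled measure makes the lemmas on integrals applicable to the density
    integral, which is taken against a bare set function. *)
Lemma borel_measure : exists nu : {measure set (borel_rV R d) -> \bar R},
  (nu : set (borel_rV R d) -> \bar R) = mu.
Proof.
have sa : semi_sigma_additive (mu : set (borel_rV R d) -> \bar R).
  move=> F mF tF mUF; apply: (@caratheodory_measure_sigma_additive _ _ mu) => //.
    by move=> k; exact: borel_caratheodory (mF k).
  exact: borel_caratheodory mUF.
pose nuM := isMeasure.Build _ (borel_rV R d) R (mu : set (borel_rV R d) -> \bar R)
  (outer_measure0 mu) (outer_measure_ge0 mu) sa.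
pose nu : {measure set (borel_rV R d) -> \bar R} :=
  HB.pack (mu : set (borel_rV R d) -> \bar R) nuM.
by exists nu.
Qed.

End borel_caratheodory.

Section bounded_density.
Context {R : realType} {d : nat}.

Lemma open_measurable_rV (U : set 'rV[R]_d) : open U ->
  measurable (U : set (borel_rV R d)).
Proof. exact: sub_sigma_algebra. Qed.

Lemma closed_measurable_rV (U : set 'rV[R]_d) : closed U ->
  measurable (U : set (borel_rV R d)).
Proof.
move=> cU; rewrite -(setCK (U : set (borel_rV R d))); apply: measurableC.
by apply: open_measurable_rV; exact: closed_openC.
Qed.

Lemma bounded_density_le (P : probability (borel_rV R d) R)
    (nu : {measure set (borel_rV R d) -> \bar R}) (D : set (borel_rV R d)) :
  measurable D -> has_bounded_density P nu D ->
  exists2 K : R, 0 <= K & forall A : set (borel_rV R d), measurable A ->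
    (P A <= K%:E * nu (A `&` D))%E.
Proof.
(* The absolute value covers an empty D, for which K may be negative. *)
move=> mD [p [mp [K Kp] PE]]; exists `|K| => // A mA; rewrite PE//.
have mAD : measurable (A `&` D) by exact: measurableI.
rewrite -integral_cst//; apply: ge0_le_integral => //.
- by move=> x [_ /Kp/andP[]]; rewrite lee_fin.
- by apply/measurable_EFinP; exact: measurable_funS mp.
- by move=> x [_ /Kp/andP[_ pK]]; rewrite lee_fin (le_trans pK)// ler_norm.
Qed.

End bounded_density.

(** * Hausdorff measure on the Borel sets *)

Section hausdorff_outer_measure.
Context {R : realType} {d : nat}.
Implicit Types (A B : set 'rV[R]_d) (m : nat).
Local Open Scope ereal_scope.

Lemma hausdorff_cost_ge0 m A : 0 <= hausdorff_cost m A.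
Proof.
rewrite /hausdorff_cost; case: ifPn => // /set0P[x Ax].
rewrite lee_fin exprn_ge0// fine_ge0//.
by apply: ereal_sup_ubound; exists x => //; exists x => //; rewrite subrr enorm0.
Qed.

Lemma hausdorff_cost0 m : hausdorff_cost m (set0 : set 'rV[R]_d) = 0.
Proof. by rewrite /hausdorff_cost eqxx. Qed.

(** A supremum over the empty set; thus [set0] fits every [delta] and can pad a cover. *)
Lemma diameter0 : diameter (set0 : set 'rV[R]_d) = -oo.
Proof. by rewrite /diameter image2E set0X image_set0 ereal_sup0. Qed.

Lemma hausdorff_preE m delta A : hausdorff_pre m delta A =
  covering_cost id (hausdorff_cost m) [set F | diameter F <= delta%:E] A.
Proof. by []. Qed.

Lemma hausdorff_pre_ge0 m delta A : 0 <= hausdorff_pre m delta A.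
Proof. by rewrite hausdorff_preE covering_cost_ge0//; exact: hausdorff_cost_ge0. Qed.

Lemma hausdorff_pre_le m (delta delta' : R) A : (delta <= delta')%R ->
  hausdorff_pre m delta' A <= hausdorff_pre m delta A.
Proof.
move=> dd; apply: ereal_inf_le_tmp => _ [F [dF AF] <-]; exists F => //.
by split=> // k; rewrite (le_trans (dF k))// lee_fin.
Qed.

Lemma hausdorff_pre_unnormalized m (delta : R) A : (0 < delta)%R ->
  hausdorff_pre m delta A <= hausdorff_unnormalized m A.
Proof. by move=> d0; apply: ereal_sup_ubound; exists delta. Qed.

Lemma hausdorff_unnormalized_ge0 m A : 0 <= hausdorff_unnormalized m A.
Proof. exact: le_trans (hausdorff_pre_ge0 m 1 A) (hausdorff_pre_unnormalized _ _ _). Qed.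

Lemma hausdorff_unnormalized0 m : hausdorff_unnormalized m (set0 : set 'rV[R]_d) = 0.
Proof.
apply/eqP; rewrite eq_le hausdorff_unnormalized_ge0 andbT.
apply: ge_ereal_sup => _ [delta /= d0 <-].
apply: ereal_inf_lbound; exists (fun=> set0).
  by split=> // k; rewrite diameter0 leNye.
by rewrite eseries0// => k _ _; rewrite hausdorff_cost0.
Qed.

Lemma le_hausdorff_unnormalized m :
  {homo @hausdorff_unnormalized R d m : A B / A `<=` B >-> A <= B}.
Proof.
move=> A B AB; apply: ge_ereal_sup => _ [delta /= d0 <-].
apply: le_trans (hausdorff_pre_unnormalized m B d0).
by rewrite !hausdorff_preE le_covering_cost.
Qed.

Lemma hausdorff_unnormalized_sigma_subadditive m :
  sigma_subadditive (@hausdorff_unnormalized R d m).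
Proof.
move=> F; apply: ge_ereal_sup => _ [delta /= d0 <-].
have := @covering_cost_sigma_subadditive R 'rV[R]_d _ id _
  (hausdorff_cost_ge0 m) [set G | diameter G <= delta%:E] F.
move=> /le_trans; apply.
apply: lee_nneseries => [n _ _|n _]; first exact: hausdorff_pre_ge0.
exact: hausdorff_pre_unnormalized.
Qed.

HB.instance Definition _ m := isOuterMeasure.Build R 'rV[R]_d
  (@hausdorff_unnormalized R d m) (hausdorff_unnormalized0 m)
  (hausdorff_unnormalized_ge0 m) (@le_hausdorff_unnormalized m)
  (@hausdorff_unnormalized_sigma_subadditive m).

(** A set of diameter below the gap cannot meet both half-spaces, so every admissible cover splits
    into a cover of A and a cover of B. *)
Lemma hausdorff_pre_separated m (i : 'I_d) (c c' delta : R) A B :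
  (delta < c' - c)%R -> A `<=` [set x | (x ord0 i <= c)%R] ->
  B `<=` [set x | (c' <= x ord0 i)%R] ->
  hausdorff_pre m delta A + hausdorff_pre m delta B <= hausdorff_pre m delta (A `|` B).
Proof.
move=> dcc Ac Bc; apply: le_ereal_inf_tmp => _ [F [dF ABF] <-].
pose left_ k := `[< F k `&` [set x | (x ord0 i <= c)%R] !=set0 >].
pose FA k := if left_ k then F k else set0.
pose FB k := if left_ k then set0 else F k.
have -> : \sum_(0 <= k <oo) hausdorff_cost m (F k) =
    \sum_(0 <= k <oo) hausdorff_cost m (FA k) + \sum_(0 <= k <oo) hausdorff_cost m (FB k).
  rewrite -nneseriesD; try by move=> *; exact: hausdorff_cost_ge0.
  apply: eq_eseriesr => k _; rewrite /FA /FB.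
  by case: (left_ k); rewrite hausdorff_cost0 ?adde0 ?add0e.
apply: leeD; apply: ereal_inf_lbound.
- exists FA => //; split=> [k|x Ax].
    by rewrite /FA; case: ifP => // _; rewrite diameter0 leNye.
  have [k _ Fkx] := ABF x (or_introl Ax); exists k => //.
  by rewrite /FA ifT//; apply/asboolP; exists x; split=> //; exact: Ac.
- exists FB => //; split=> [k|x Bx].
    by rewrite /FB; case: ifP => // _; rewrite diameter0 leNye.
  have [k _ Fkx] := ABF x (or_intror Bx); exists k => //.
  rewrite /FB ifF//; apply/asboolP => -[y [Fky /= yc]].
  have : (enorm (x - y))%:E <= delta%:E.
    by apply: le_trans (dF k); apply: ereal_sup_ubound; exists x => //; exists y.
  rewrite lee_fin leNgt => /negP; apply; apply: (lt_le_trans dcc).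
  rewrite (le_trans _ (coord_le_enorm _ i))// (le_trans _ (ler_norm _))// !mxE.
  by have /= := Bc _ Bx; lra.
Qed.

(** Shrinking [delta] increases [hausdorff_pre], so the two scales of the suprema on the left are
    replaced by a common one smaller than the gap. *)
Lemma hausdorff_separated m (i : 'I_d) (c c' : R) A B :
  (c < c')%R -> A `<=` [set x | (x ord0 i <= c)%R] ->
  B `<=` [set x | (c' <= x ord0 i)%R] ->
  hausdorff_unnormalized m A + hausdorff_unnormalized m B <=
  hausdorff_unnormalized m (A `|` B).
Proof.
move=> cc Ac Bc; have [->|ABoo] := eqVneq (hausdorff_unnormalized m (A `|` B)) +oo.
  exact: leey.
have fin C : C `<=` A `|` B -> hausdorff_unnormalized m C \is a fin_num.
  move=> CAB; rewrite ge0_fin_numE ?hausdorff_unnormalized_ge0//.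
  apply: le_lt_trans (@le_hausdorff_unnormalized m _ _ CAB) _.
  by rewrite lt_neqAle ABoo leey.
have finA := fin A (@subsetUl _ _ _); have finB := fin B (@subsetUr _ _ _).
have key (d1 d2 : R) : (0 < d1)%R -> (0 < d2)%R ->
    hausdorff_pre m d1 A + hausdorff_pre m d2 B <= hausdorff_unnormalized m (A `|` B).
  move=> d10 d20; pose delta := (Num.min ((c' - c) / 2) (Num.min d1 d2))%R.
  have delta0 : (0 < delta)%R by rewrite !lt_min d10 d20 divr_gt0// subr_gt0.
  apply: le_trans (hausdorff_pre_unnormalized m _ delta0).
  apply: le_trans (hausdorff_pre_separated m (i := i) (c := c) (c' := c') _ Ac Bc).
    by apply: leeD; apply: hausdorff_pre_le; rewrite !ge_min lexx ?orbT.
  apply: (@le_lt_trans _ _ ((c' - c) / 2)%R); first by rewrite ge_min lexx.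
  lra.
rewrite -leeBrDr//; apply: ge_ereal_sup => _ [d1 /= d10 <-].
have finA1 : hausdorff_pre m d1 A \is a fin_num.
  rewrite ge0_fin_numE ?hausdorff_pre_ge0//.
  apply: le_lt_trans (hausdorff_pre_unnormalized m A d10) _.
  by rewrite -ge0_fin_numE// hausdorff_unnormalized_ge0.
rewrite leeBrDr// addeC -leeBrDr//; apply: ge_ereal_sup => _ [d2 /= d20 <-].
by rewrite leeBrDr// addeC key.
Qed.

Lemma hausdorff_borel_measure m : exists nu : {measure set (borel_rV R d) -> \bar R},
  (nu : set (borel_rV R d) -> \bar R) = hausdorff m.
Proof.
have [nu nuE] := borel_measure (@hausdorff_separated m).
pose a := (fine (hausdorff_unnormalized m (unit_cube m : set 'rV[R]_d)))^-1%R.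
have a0 : (0 <= a)%R by rewrite invr_ge0 fine_ge0// hausdorff_unnormalized_ge0.
exists (mscale (NngNum a0) nu).
have nuA A : nu A = hausdorff_unnormalized m A by rewrite nuE.
by apply/funext => A; rewrite /hausdorff -(nuA A).
Qed.

Lemma hausdorff_cover_le m (n : nat) (b : R) A (F : nat -> set 'rV[R]_d) (delta : R) :
  (0 <= b <= delta)%R ->
  A `<=` \bigcup_k F k -> (forall k, (n <= k)%N -> F k = set0) ->
  (forall k y z, F k y -> F k z -> (enorm (y - z) <= b)%R) ->
  hausdorff_pre m delta A <= (n%:R * b ^+ m)%:E.
Proof.
move=> /andP[b0 bdelta] AF F0 Fb.
have dF k : diameter (F k) <= b%:E.
  by apply: ge_ereal_sup => _ [y Fy [z Fz <-]]; rewrite lee_fin; exact: Fb Fz.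
apply: (@le_trans _ _ (\sum_(0 <= k <oo) hausdorff_cost m (F k))).
  apply: ereal_inf_lbound; exists F => //; split=> // k.
  by rewrite (le_trans (dF k))// lee_fin.
rewrite (nneseries_split _ n) ?add0n; last by move=> *; exact: hausdorff_cost_ge0.
rewrite [X in _ + X]eseries0 ?adde0; last first.
  by move=> k nk _; rewrite F0// hausdorff_cost0.
rewrite big_mkord; apply: (@le_trans _ _ (\sum_(k < n) (b ^+ m)%:E)); last first.
  by rewrite sumEFin sumr_const card_ord mulr_natl.
apply: lee_sum => k _; rewrite /hausdorff_cost; case: ifPn => [_|/set0P[x Fx]].
  by rewrite lee_fin exprn_ge0.
have dF0 : 0 <= diameter (F k).
  by apply: ereal_sup_ubound; exists x => //; exists x => //; rewrite subrr enorm0.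
rewrite lee_fin lerXn2r// ?nnegrE ?fine_ge0//.
by rewrite -lee_fin fineK// ge0_fin_numE// (le_lt_trans (dF k))// ltry.
Qed.

End hausdorff_outer_measure.

(** * Lebesgue measure on the Borel sets *)

Section lebesgue_outer_measure.
Context {R : realType} {d : nat}.
Implicit Types (A B : set 'rV[R]_d.+1) (ab : 'rV[R]_d.+1 * 'rV[R]_d.+1).
Local Open Scope ereal_scope.

Lemma box_volume_ge0 ab : (0 <= box_volume ab)%R.
Proof. by apply: prodr_ge0 => i _; rewrite le_max lexx. Qed.

(** The degenerate box at the origin pads covers at no cost; in dimension 0 the empty product would
    give it volume 1. *)
Lemma box_volume0 : box_volume (0%R, 0%R : 'rV[R]_d.+1) = 0%R.
Proof.
by rewrite /box_volume big_ord_recl/= !mxE subrr /Order.max ltxx mul0r.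
Qed.

Lemma lebesgue_rVE A : lebesgue_rV A =
  covering_cost box (fun ab => (box_volume ab)%:E) setT A.
Proof.
by congr ereal_inf; apply/seteqP; split=> _ [F FA <-]; exists F => //; case: FA.
Qed.

Lemma lebesgue_rV_ge0 A : 0 <= lebesgue_rV A.
Proof.
by rewrite lebesgue_rVE covering_cost_ge0// => ab; rewrite lee_fin box_volume_ge0.
Qed.

Lemma lebesgue_rV0 : lebesgue_rV (set0 : set 'rV[R]_d.+1) = 0.
Proof.
apply/eqP; rewrite eq_le lebesgue_rV_ge0 andbT.
apply: ereal_inf_lbound; exists (fun=> (0, 0)%R) => //.
by rewrite eseries0// => k _ _; rewrite box_volume0.
Qed.

Lemma le_lebesgue_rV : {homo @lebesgue_rV R d.+1 : A B / A `<=` B >-> A <= B}.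
Proof. by move=> A B AB; rewrite !lebesgue_rVE le_covering_cost. Qed.

Lemma lebesgue_rV_sigma_subadditive : sigma_subadditive (@lebesgue_rV R d.+1).
Proof.
move=> F; rewrite lebesgue_rVE (eq_eseriesr (fun k _ => lebesgue_rVE (F k))).
by apply: covering_cost_sigma_subadditive => ab; rewrite lee_fin box_volume_ge0.
Qed.

HB.instance Definition _ := isOuterMeasure.Build R 'rV[R]_d.+1
  (@lebesgue_rV R d.+1) lebesgue_rV0 lebesgue_rV_ge0 le_lebesgue_rV
  lebesgue_rV_sigma_subadditive.

Let cut_below (i : 'I_d.+1) (c : R) ab : 'rV[R]_d.+1 * 'rV[R]_d.+1 :=
  (ab.1, \row_j if j == i then Num.min (ab.2 ord0 j) c else ab.2 ord0 j)%R.

Let cut_above (i : 'I_d.+1) (c : R) ab : 'rV[R]_d.+1 * 'rV[R]_d.+1 :=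
  (\row_j if j == i then Num.max (ab.1 ord0 j) c else ab.1 ord0 j, ab.2)%R.

Let box_volume_cut i c ab :
  (box_volume (cut_below i c ab) + box_volume (cut_above i c ab) <= box_volume ab)%R.
Proof.
have volE ab' : box_volume ab' = (Num.max 0 (ab'.2 ord0 i - ab'.1 ord0 i) *
    \prod_(j | j != i) Num.max 0 (ab'.2 ord0 j - ab'.1 ord0 j))%R.
  by rewrite /box_volume (bigD1 i).
rewrite !volE; set r := (\prod_(j | j != i) Num.max 0 (ab.2 ord0 j - ab.1 ord0 j))%R.
have r0 : (0 <= r)%R by apply: prodr_ge0 => j _; rewrite le_max lexx.
have -> : (\prod_(j | j != i) Num.max 0 ((cut_below i c ab).2 ord0 j -
    (cut_below i c ab).1 ord0 j))%R = r.
  by apply: eq_bigr => j /negbTE ji; rewrite !mxE ji.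
have -> : (\prod_(j | j != i) Num.max 0 ((cut_above i c ab).2 ord0 j -
    (cut_above i c ab).1 ord0 j))%R = r.
  by apply: eq_bigr => j /negbTE ji; rewrite !mxE ji.
rewrite -mulrDl ler_wpM2r// !mxE eqxx.
move: (ab.1 ord0 i) (ab.2 ord0 i) => a b.
case: (leP b c) => bc; case: (leP a c) => ac; case: (leP 0 (b - a))%R => ba;
  case: (leP 0 (b - c))%R => bc0; case: (leP 0 (c - a))%R => ca0; lra.
Qed.

(** Cutting every box of a cover along the hyperplane at c gives a cover of A and a cover of B at no
    extra volume. *)
Lemma lebesgue_rV_separated (i : 'I_d.+1) (c c' : R) A B :
  (c < c')%R -> A `<=` [set x | (x ord0 i <= c)%R] ->
  B `<=` [set x | (c' <= x ord0 i)%R] ->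
  lebesgue_rV A + lebesgue_rV B <= lebesgue_rV (A `|` B).
Proof.
move=> cc Ac Bc; apply: le_ereal_inf_tmp => _ [F ABF <-].
apply: (@le_trans _ _ (\sum_(0 <= k <oo) (box_volume (cut_below i c (F k)))%:E +
    \sum_(0 <= k <oo) (box_volume (cut_above i c (F k)))%:E)); last first.
  rewrite -nneseriesD; try by move=> *; rewrite lee_fin box_volume_ge0.
  apply: lee_nneseries => [k _ _|k _]; last by rewrite -EFinD lee_fin.
  by rewrite adde_ge0// lee_fin box_volume_ge0.
apply: leeD; apply: ereal_inf_lbound.
- exists (fun k => cut_below i c (F k)) => // x Ax.
  have [k _ Fx] := ABF x (or_introl Ax); exists k => // j /=.
  have /andP[-> xb] := Fx j; rewrite !mxE; case: eqP => [ji|_] //.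
  by rewrite le_min xb/= ji; exact: Ac.
- exists (fun k => cut_above i c (F k)) => // x Bx.
  have [k _ Fx] := ABF x (or_intror Bx); exists k => // j /=.
  have /andP[ax ->] := Fx j; rewrite !mxE andbT; case: eqP => [ji|_] //.
  by rewrite ge_max ax/= ji (le_trans (ltW cc))//; exact: Bc.
Qed.

Lemma lebesgue_rV_eball (x : 'rV[R]_d.+1) (r : R) : (0 < r)%R ->
  lebesgue_rV (eball x r) <= ((2 * r) ^+ d.+1)%:E.
Proof.
move=> r0; pose ab : 'rV[R]_d.+1 * 'rV[R]_d.+1 := (x - const_mx r, x + const_mx r)%R.
pose F k : 'rV[R]_d.+1 * 'rV[R]_d.+1 := if k == 0%N then ab else (0, 0)%R.
apply: (@le_trans _ _ (\sum_(0 <= k <oo) (box_volume (F k))%:E)).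
  apply: ereal_inf_lbound; exists F => // y /= yx; exists 0%N => // i.
  rewrite /F /ab /= !mxE; have := le_lt_trans (coord_le_enorm (y - x) i) yx.
  by rewrite !mxE ltr_norml => /andP[h1 h2]; apply/andP; split; lra.
rewrite (nneseries_split _ 1); last by move=> *; rewrite lee_fin box_volume_ge0.
rewrite big_nat1 eseries0 ?adde0; last by case=> // k _ _; rewrite box_volume0.
rewrite lee_fin -[X in (_ ^+ X)%R]card_ord -prodr_const.
apply: ler_prod => i _; rewrite le_max lexx /= /ab /= !mxE ge_max; apply/andP.
by split; lra.
Qed.

End lebesgue_outer_measure.

(** * Volume dimension *)

Section volume_dimension_estimates.
Context {R : realType} {d : nat} (P : probability (borel_rV R d) R).
Variable X : set 'rV[R]_d.

(** The limit superior is an infimum, over punctured right neighbourhoods of 0, of suprema; it is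
    finite from above exactly when one bound holds uniformly on a small interval. *)
Lemma limf_esup_ball_growthP (nu : R) :
  (limf_esup (fun r : R => ereal_sup [set P (eball x r) / (r `^ nu)%:E | x in X])
     0^'+ < +oo)%E <->
  exists K r0 : R, [/\ 0 <= K, 0 < r0 & forall x r, X x -> 0 < r < r0 ->
    (P (eball x r) <= (K * r `^ nu)%:E)%E].
Proof.
have div_le (K r : R) x : 0 < r ->
    (P (eball x r) / (r `^ nu)%:E <= K%:E)%E = (P (eball x r) <= (K * r `^ nu)%:E)%E.
  move=> r0; have rnu := powR_gt0 nu r0.
  by rewrite inver gt_eqF// lee_pdivrMr.
split=> [/ereal_inf_lt[_ [V V0 <-] Voo]|[K [r0 [K0 r00 PK]]]].
  have [r0 r00 r0V] : exists2 r0 : R, 0 < r0 & forall r, 0 < r < r0 -> V r.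
    case: V0 => e /= e0 eV; exists e => // r /andP[r0 re].
    by apply: eV => //=; rewrite sub0r normrN gtr0_norm.
  have [K [K0 VK]] : exists K : R, 0 <= K /\ (ereal_sup [set
      ereal_sup [set P (eball x r) / (r `^ nu)%:E | x in X] | r in V] <= K%:E)%E.
    move: Voo; case: (X in (X < _)%E) => [K _|//|_].
      by exists `|K|; split=> //; rewrite lee_fin ler_norm.
    (* The supremum is -oo when [X] is empty. *)
    by exists 0; rewrite leNye.
  exists K, r0; split=> // x r Xx /andP[rgt0 rr0]; rewrite -div_le//.
  have Vr : V r by apply: r0V; rewrite rgt0.
  apply: le_trans VK; apply: le_trans; last first.
    by apply: ereal_sup_ubound; exists r; [exact: Vr|reflexivity].
  by apply: ereal_sup_ubound; exists x.
apply: le_lt_trans (ltry K); apply: le_trans.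
  apply: ereal_inf_lbound; exists [set r | 0 < r < r0]; last reflexivity.
  apply: filterS2 (nbhs_right_gt 0) (nbhs_right_lt r00) => r r1 r2.
  by rewrite /= r1.
apply: ge_ereal_sup => _ [r /andP[r_gt0 rr0] <-]; apply: ge_ereal_sup => _ [x Xx <-].
by rewrite div_le// PK// r_gt0.
Qed.

(** Separability: countably many balls of one radius cover the space, so it is enough to show that
    each meets [M] and [X] in a null set. *)
Lemma rational_eball (x : 'rV[R]_d) (r : R) : 0 < r ->
  exists q : 'rV[rat]_d, eball (map_mx ratr q) r x.
Proof.
move=> r0; pose e := r / (d%:R + 1).
have e0 : 0 < e by rewrite divr_gt0// ltr_wpDl.
have /choice[q qP] : forall i, exists q : rat, x ord0 i < ratr q < x ord0 i + e.
  move=> i; have [|q] := @rat_in_itvoo R (x ord0 i) (x ord0 i + e).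
    by rewrite ltrDl.
  by rewrite in_itv /=; exists q.
exists (\row_i q i); apply: (@le_lt_trans _ _ (d%:R * e)); last first.
  by rewrite /e mulrCA gtr_pMr// ltr_pdivrMr ?ltr_wpDl// mul1r ltrDl.
apply: enorm_le_coord => i; have := qP i.
by rewrite !mxE => /andP[? ?]; rewrite ler_norml; apply/andP; split; lra.
Qed.

(** In a ball of fixed radius r, the d^m N^m pieces have mass at most K (b / N)^nu each within [X];
    the total is a constant times N^(m - nu), which tends to 0. *)
Lemma graph_charts_null (m : nat) (M : set 'rV[R]_d) (r0 C nu K r1 : R) :
  measurable (X : set (borel_rV R d)) -> closed M ->
  0 < r0 -> 0 < C -> graph_charts m M r0 C -> m%:R < nu -> 0 <= K -> 0 < r1 ->
  (forall x r, X x -> 0 < r < r1 -> (P (eball x r) <= (K * r `^ nu)%:E)%E) ->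
  P (M `&` X) = 0%E.
Proof.
move=> mX cM r00 C0 chartM mnu K0 r10 PK; pose r := r0 / 2.
have rgt0 : 0 < r by rewrite divr_gt0.
have mM := closed_measurable_rV cM.
have mB x e : measurable (eball x e : set (borel_rV R d)).
  by apply: open_measurable_rV; exact: open_eball.
have mMX := measurableI _ _ mM mX.
suff null x : P (M `&` X `&` eball x r) = 0%E.
  apply: measure_negligible => //.
  pose F k : set (borel_rV R d) := if unpickle k is Some q then
    M `&` X `&` eball (map_mx ratr (q : 'rV[rat]_d)) r else set0.
  apply: (@negligibleS _ _ _ P (\bigcup_k F k)).
    move=> x MXx; have [q qx] := rational_eball x rgt0.
    by exists (pickle q) => //; rewrite /F pickleK.
  apply: negligible_bigcup => k; rewrite /F; case: unpickle => [q|].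
    by apply/negligibleP; [exact: measurableI|exact: null].
  exact: negligible_set0.
have mMXB := measurableI _ _ mMX (mB x r).
(* The added 1 makes [b / N%:R] strictly larger than the diameter bound of the pieces, as the
   enclosing balls are open. *)
pose b := 2 * C * r + 1; have b0 : 0 < b by rewrite ltr_wpDl// !mulr_ge0// ltW.
pose s := nu - m%:R; have s0 : 0 < s by rewrite subr_gt0.
have bound N : (0 < N)%N -> b / N%:R < r1 ->
    (P (M `&` X `&` eball x r) <= ((d ^ m)%:R * K * b `^ nu / N%:R `^ s)%:E)%E.
  move=> N0 bN; have NR0 : 0 < N%:R :> R by rewrite ltr0n.
  have rr0 : 2 * r <= r0 by rewrite /r; lra.
  have [F [MF F0 Fb]] := graph_charts_cover x chartM rgt0 rr0 N0.
  (* Nothing is known about measurability of the pieces; each one that meets [X] is enclosed in a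
     ball centred in [X], where the growth bound applies. *)
  have /choice[G GP] : forall k, exists G : set (borel_rV R d),
      [/\ measurable G, F k `&` X `<=` G & (P G <= (K * (b / N%:R) `^ nu)%:E)%E].
    move=> k; have [[y [Fy Xy]]|FX0] := pselect (F k `&` X !=set0).
      exists (eball y (b / N%:R)); split => //; last first.
        by apply: PK => //; rewrite divr_gt0.
      move=> z [Fz Xz] /=; apply: le_lt_trans (Fb _ _ _ Fz Fy) _.
      by rewrite ltr_pM2r ?invr_gt0// /b ltrDl.
    exists set0; split => //; first by move=> z FXz; apply: FX0; exists z.
    by rewrite measure0 lee_fin mulr_ge0// powR_ge0.
  apply: (@le_trans _ _ (\sum_(k < d ^ m * N ^ m) P (G k))%E).
    apply: content_subadditive => // [k _|z [[Mz Xz] xz]]; first by case: (GP k).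
    have [k _ Fz] := MF z (conj Mz xz); rewrite -bigcup_mkord; exists k.
      by rewrite /= ltnNge; apply/negP => /F0 Fk0; rewrite Fk0 in Fz.
    by have [_ FG _] := GP k; exact: FG.
  apply: (@le_trans _ _ (\sum_(k < d ^ m * N ^ m) (K * (b / N%:R) `^ nu)%:E)%E).
    by apply: lee_sum => k _; case: (GP k).
  rewrite sumEFin sumr_const card_ord lee_fin -[leLHS]mulr_natr natrM.
  have -> : (b / N%:R) `^ nu = b `^ nu / (N%:R ^+ m * N%:R `^ s).
    rewrite powRM ?(ltW b0) ?invr_ge0// -powR_inv1// -powRrM mulN1r powRN.
    rewrite -powR_mulrn// -powRD; last by rewrite (gt_eqF NR0) implybT.
    by rewrite /s addrC subrK.
  rewrite [(N ^ m)%:R]natrX le_eqVlt; apply/orP; left; apply/eqP.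
  have Ns : N%:R `^ s != 0 by rewrite gt_eqF// powR_gt0.
  have Nm : N%:R ^+ m != 0 :> R by rewrite expf_neq0// gt_eqF.
  move: (N%:R `^ s) (N%:R ^+ m) (b `^ nu) ((d ^ m)%:R : R) Ns Nm => u v w D u0 v0.
  by field; rewrite u0 v0.
apply/eqP; rewrite eq_le measure_ge0 andbT; apply/lee_addgt0Pr => e e0; rewrite add0e.
pose c := (d ^ m)%:R * K * b `^ nu.
have c0 : 0 <= c by rewrite !mulr_ge0 ?powR_ge0.
(* Large enough that [b / N%:R < r1] and that c divided by the power s of N is at most [e]. *)
pose N := (Num.truncn (Num.max (b / r1) ((c / e) `^ s^-1))).+1.
have NP : Num.max (b / r1) ((c / e) `^ s^-1) < N%:R by exact: truncnS_gt.
have NR0 : 0 < N%:R :> R by rewrite ltr0n.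
apply: (le_trans (bound N _ _)) => //.
  by rewrite ltr_pdivrMr// mulrC -ltr_pdivrMr//; apply: le_lt_trans NP; rewrite le_max lexx.
rewrite lee_fin -/c ler_pdivrMr ?powR_gt0// mulrC -ler_pdivrMr//.
have -> : c / e = ((c / e) `^ s^-1) `^ s.
  by rewrite -powRrM mulVf ?gt_eqF// powRr1// divr_ge0// ltW.
apply: ge0_ler_powR; rewrite ?nnegrE ?powR_ge0 ?(ltW s0) ?(ltW NR0)//.
by apply: ltW; apply: le_lt_trans NP; rewrite le_max lexx orbT.
Qed.

Lemma volume_dimension_eq (m : nat) (M : set 'rV[R]_d) (r0 C r1 K : R) :
  measurable (X : set (borel_rV R d)) -> closed M ->
  0 < r0 -> 0 < C -> graph_charts m M r0 C -> (0 < P (M `&` X))%E ->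
  0 <= K -> 0 < r1 ->
  (forall x r, 0 < r < r1 -> (P (eball x r) <= (K * r ^+ m)%:E)%E) ->
  volume_dimension P X = m%:R%:E.
Proof.
move=> mX cM r00 C0 chartM PMX K0 r10 PK; apply/eqP; rewrite eq_le; apply/andP; split.
  apply: ge_ereal_sup => _ [nu [nu0 /limf_esup_ball_growthP[K' [r2 [K'0 r20 PK']]]] <-].
  rewrite lee_fin leNgt; apply/negP => mnu; move: PMX.
  by rewrite (graph_charts_null mX cM r00 C0 chartM mnu K'0 r20 PK') ltxx.
apply: ereal_sup_ubound; exists m%:R => //; split=> //.
apply/limf_esup_ball_growthP; exists K, r1; split=> // x r _ r01.
by rewrite powR_mulrn ?PK//; case/andP: r01 => /ltW.
Qed.

End volume_dimension_estimates.

(** With N chosen so that [2 * C * r / N%:R <= delta], the d^m N^m pieces cost at most (2 C r / N)^m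
    each; N cancels, so the bound is independent of [delta]. *)
Lemma hausdorff_graph_charts {R : realType} {d m : nat} (M : set 'rV[R]_d)
    (r0 C r : R) (x : 'rV[R]_d) :
  0 < C -> graph_charts m M r0 C -> 0 < r -> 2 * r <= r0 ->
  (hausdorff_unnormalized m (eball x r `&` M) <=
   ((d ^ m)%:R * (2 * C) ^+ m * r ^+ m)%:E)%E.
Proof.
move=> C0 chartM rgt0 rr0; apply: ge_ereal_sup => _ [delta /= delta0 <-].
pose N := (Num.truncn (2 * C * r / delta)).+1.
have NP : 2 * C * r / delta < N%:R by exact: truncnS_gt.
have NR0 : 0 < N%:R :> R by rewrite ltr0n.
have [F [MF F0 Fb]] := graph_charts_cover x chartM rgt0 rr0 (ltn0Sn _ : (0 < N)%N).
have bdelta : 0 <= 2 * C * r / N%:R <= delta.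
  rewrite divr_ge0 ?mulr_ge0 ?(ltW C0) ?(ltW rgt0)//=.
  rewrite ler_pdivrMr// (mulrC delta) -ler_pdivrMr//. exact: ltW.
rewrite setIC; apply: le_trans (hausdorff_cover_le m bdelta MF F0 Fb) _.
rewrite lee_fin natrM [(N ^ m)%:R]natrX exprMn exprVn exprMn le_eqVlt.
apply/orP; left; apply/eqP; have Nm : N%:R ^+ m != 0 :> R by rewrite expf_neq0// gt_eqF.
by move: (N%:R ^+ m) ((2 * C) ^+ m) (r ^+ m) ((d ^ m)%:R : R) Nm => u v w D u0; field.
Qed.

Theorem proposition3 (R : realType) (d : nat) (hd : (0 < d)%N)
    (X : set 'rV[R]_d) (mX : measurable (X : set (borel_rV R d)))
    (P : probability (borel_rV R d) R) :
  (forall (dM : nat) (M : set 'rV[R]_d),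
     (1 <= dM <= d)%N ->
     closed M -> embedded_submanifold dM M ->
     (0 < reach M)%E ->
     (0 < P (M `&` X))%E ->
     prob_support P `<=` M ->
     has_bounded_density P (hausdorff dM) M ->
     volume_dimension P X = dM%:R%:E)
  /\
  ((0 < P X)%E ->
   has_bounded_density P lebesgue_rV [set: borel_rV R d] ->
   volume_dimension P X = d%:R%:E).
Proof.
split=> [m M _ cM sM rM PMX _|PX].
  have [r0 [C [r00 C0 chartM]]] := submanifold_graph_charts cM sM rM.
  have [nu nuE] := @hausdorff_borel_measure R d m.
  rewrite -nuE => /(bounded_density_le (closed_measurable_rV cM))[K K0 PK].
  pose a := (fine (hausdorff_unnormalized m (unit_cube m : set 'rV[R]_d)))^-1.
  have a0 : 0 <= a by rewrite invr_ge0 fine_ge0// hausdorff_unnormalized_ge0.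
  (* [K] bounds the density, [a] normalizes the Hausdorff measure, and the rest is the constant of
     [hausdorff_graph_charts], valid for [2 * r <= r0]. *)
  apply: (@volume_dimension_eq _ _ P X m M r0 C (r0 / 2)
    (K * (a * ((d ^ m)%:R * (2 * C) ^+ m)))) => //.
  - by rewrite !mulr_ge0// exprn_ge0// mulr_ge0// ltW.
  - by rewrite divr_gt0.
  - move=> x r /andP[rgt0 rr0].
    apply: (le_trans (PK _ (open_measurable_rV (@open_eball _ _ x r)))).
    rewrite nuE -!mulrA EFinM lee_wpmul2l ?lee_fin// EFinM lee_wpmul2l ?lee_fin//.
    by rewrite mulrA; apply: (hausdorff_graph_charts x C0 chartM) => //; lra.
(* [lebesgue_rV] is an outer measure in successor dimensions, where the degenerate box has volume
   0. *)
case: d hd X mX P PX => // d _ X mX P PX.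
have [nu nuE] := borel_measure (@lebesgue_rV_separated R d).
rewrite -nuE => /(bounded_density_le measurableT)[K K0 PK].
(* The radius 1 is an arbitrary scale; [2 ^+ d.+1] comes from the cube of side [2 * r] around the
   ball. *)
apply: (@volume_dimension_eq _ _ P X d.+1 setT 1 (d.+1%:R + 1) 1 (K * 2 ^+ d.+1)) => //.
- exact: full_graph_charts.
- by rewrite setTI.
- by rewrite mulr_ge0// exprn_ge0.
move=> x r /andP[rgt0 _].
apply: (le_trans (PK _ (open_measurable_rV (@open_eball _ _ x r)))).
rewrite setIT nuE -mulrA -exprMn EFinM lee_wpmul2l ?lee_fin//.
exact: lebesgue_rV_eball.
Qed.
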